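(* Let $\mathbf v,\mathbf u\in (C(\mathbb T^N))^m$ be, respectively, a subsolution and a supersolution of the critical weakly coupled system $$H_i(x,Du_i)+\big(B(x)\mathbf u(x)\big)_i=0\quad\text{in }\mathbb T^N,\qquad i\in\{1,\dots,m\}.$$ Assume that for every $x\in\mathcal A$ there exists $i\in\{1,\dots,m\}$ such that $v_i(x)\leqslant u_i(x)$. Then $\mathbf v(x)\leqslant\mathbf u(x)$ for every $x\in\mathbb T^N$. In particular, two critical solutions that coincide on $\mathcal A$ coincide on the whole $\mathbb T^N$.
   Context: Let $N,m$ be positive integers, $\mathbb T^N=\mathbb R^N/\mathbb Z^N$ the flat torus, $\mathbb 1=(1,\dots,1)^T\in\mathbb R^m$; inequalities between vectors are componentwise. A convex Hamiltonian is a continuous $H:\mathbb T^N\times\mathbb R^N\to\mathbb R$ such that $p\mapsto H(x,p)$ is convex for every $x$ and there are $\alpha,\beta:\mathbb R_+\to\mathbb R$ tending to $+\infty$ at $+\infty$ with $\alpha(|p|)\leqslant H(x,p)\leqslant\beta(|p|)$ for all $(x,p)$. Let $H_1,\dots,H_m$ be convex Hamiltonians. An $m\times m$ real matrix $(b_{ij})$ is a coupling matrix if $b_{ij}\leqslant0$ for $j\ne i$ and $\sum_j b_{ij}\geqslant0$ for every $i$; it is degenerate if moreover $\sum_j b_{ij}=0$ for every $i$; a matrix is irreducible if for every nonempty $\mathcal I\subsetneq\{1,\dots,m\}$ there are $i\in\mathcal I$, $j\notin\mathcal I$ with $b_{ij}\neq0$. Let $B(x)=(b_{ij}(x))$ have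 continuous coefficients on $\mathbb T^N$ and be an irreducible degenerate coupling matrix for every $x$. Write $(B(x)\mathbf u(x))_i=\sum_j b_{ij}(x)u_j(x)$. For continuous $u$, $D^+u(x_0)$ (resp. $D^-u(x_0)$) is the set of $D\phi(x_0)$ with $\phi$ of class $C^1$ near $x_0$ and $u-\phi$ having a local maximum (resp. minimum) at $x_0$. For $a\in\mathbb R$, $\mathbf u\in(C(\mathbb T^N))^m$ is a (viscosity) subsolution [resp. supersolution] of $H_i(x,Du_i)+(B(x)\mathbf u(x))_i=a$ in $\mathbb T^N$, $i=1,\dots,m$, if for all $x$ and $i$: $H_i(x,p)+(B(x)\mathbf u(x))_i\leqslant a$ for all $p\in D^+u_i(x)$ [resp. $\geqslant a$ for all $p\in D^-u_i(x)$]; a solution is both. $\mathcal H(a)$ denotes the set of subsolutions. The critical value is $c=\inf\{a\in\mathbb R:\mathcal H(a)\neq\varnothing\}$; it is assumed, by normalization, that $c=0$. ''Critical'' sub/super/solutions refer to $a=0$. For $x,y\in\mathbb T^N$, $i,j\in\{1,\dots,m\}$ set $\Phi_{i,j}(y,x)=\sup_{\mathbf v\in\mathcal H(0)}\big(v_i(x)-v_j(y)\big)$, and let $\Phi_{\cdot,j}(y,\cdot)=(\Phi_{1,j}(y,\cdot),\dots,\Phi_{m,j}(y,\cdot))^T$. The Aubry set is $\mathcal A=\{y\in\mathbb T^N:\Phi_{\cdot,i}(y,\cdot)\text{ is a critical solution}\}$, where $i$ is any fixed index (the set does not depend on $i$). *)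

(* Defs.v *)
From HB Require Import structures.
From mathcomp Require Import all_boot all_order all_algebra.
From mathcomp Require Import generic_quotient.
From mathcomp Require Import all_classical all_reals all_analysis.
Set Implicit Arguments.
Unset Strict Implicit.
Unset Printing Implicit Defensive.
Import Order.TTheory GRing.Theory Num.Theory.
Import numFieldNormedType.Exports.
Local Open Scope classical_set_scope.
Local Open Scope ring_scope.

Section Torus.
Variables (R : realType) (N : nat).

Definition lattice_rel (x y : 'rV[R]_N) : bool :=
  `[< exists k : 'rV[int]_N, y = x + map_mx intr k >].

Lemma lattice_rel_refl : reflexive lattice_rel.
Proof.
move=> x; apply/asboolP; exists 0.
by apply/rowP => i; rewrite !mxE addr0.
Qed.

Lemma lattice_rel_sym : symmetric lattice_rel.
Proof.
have imp x y : lattice_rel x y -> lattice_rel y x.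
  move=> /asboolP[k ->]; apply/asboolP; exists (- k).
  by apply/rowP => i; rewrite !mxE rmorphN /= addrK.
by move=> x y; apply/idP/idP; apply: imp.
Qed.

Lemma lattice_rel_trans : transitive lattice_rel.
Proof.
move=> y x z /asboolP[k ->] /asboolP[l ->]; apply/asboolP; exists (k + l).
by apply/rowP => i; rewrite !mxE rmorphD /= addrA.
Qed.

Canonical lattice_equiv :=
  EquivRel lattice_rel lattice_rel_refl lattice_rel_sym lattice_rel_trans.

Definition torus : Type := quotient_topology {eq_quot lattice_rel}%qT.

HB.instance Definition _ := Topological.on torus.

Definition torus_pi : 'rV[R]_N -> torus :=
  \pi_(quotient_topology {eq_quot lattice_rel}%qT)%qT.

End Torus.

Section Derivatives.
Variables (R : realType) (N : nat).

(* The library norm on row vectors is the sup norm; the growth bounds on a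
   Hamiltonian are stated with the Euclidean one. *)
Definition enorm (p : 'rV[R]_N) : R := Num.sqrt (\sum_i p ord0 i ^+ 2).

Definition grad (phi : 'rV[R]_N -> R) (z : 'rV[R]_N) : 'rV[R]_N :=
  \row_i 'D_(delta_mx 0 i) phi z.

Definition C1_near (phi : 'rV[R]_N -> R) (z0 : 'rV[R]_N) : Prop :=
  \forall z \near z0,
    differentiable phi z /\ {for z, continuous (grad phi)}.

(* Test functions live on R^N, in the chart of the torus given by the
   projection around any lift z0 of x0. *)
Definition superdiff (u : torus R N -> R) (x0 : torus R N)
    : set 'rV[R]_N :=
  [set p | exists (z0 : 'rV[R]_N) (phi : 'rV[R]_N -> R),
    [/\ torus_pi z0 = x0, C1_near phi z0, grad phi z0 = p
      & \forall z \near z0,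
          u (torus_pi z) - phi z <= u (torus_pi z0) - phi z0]].

Definition subdiff (u : torus R N -> R) (x0 : torus R N)
    : set 'rV[R]_N :=
  [set p | exists (z0 : 'rV[R]_N) (phi : 'rV[R]_N -> R),
    [/\ torus_pi z0 = x0, C1_near phi z0, grad phi z0 = p
      & \forall z \near z0,
          u (torus_pi z0) - phi z0 <= u (torus_pi z) - phi z]].

Definition convex_hamiltonian (H : torus R N -> 'rV[R]_N -> R) : Prop :=
  [/\ continuous (fun xp : torus R N * 'rV[R]_N => H xp.1 xp.2),
      forall x, convex_function [set: 'rV[R]_N] (H x)
    & exists alpha beta : R -> R,
      [/\ alpha t @[t --> +oo] --> +oo, beta t @[t --> +oo] --> +oo
        & forall x p, alpha (enorm p) <= H x p <= beta (enorm p)]].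

End Derivatives.

Section Coupling.
Variables (R : realType) (m : nat).

Definition coupling_matrix (b : 'M[R]_m) : Prop :=
  (forall i j, j != i -> b i j <= 0) /\ (forall i, 0 <= \sum_j b i j).

Definition degenerate_coupling (b : 'M[R]_m) : Prop :=
  coupling_matrix b /\ forall i, \sum_j b i j = 0.

Definition irreducible_mx (b : 'M[R]_m) : Prop :=
  forall I : {set 'I_m}, I != finset.set0 -> I \proper [set: 'I_m]%SET ->
    exists i j, [/\ i \in I, j \notin I & b i j != 0].

End Coupling.

Section System.
Variables (R : realType) (N m : nat).
Variable H : 'I_m -> torus R N -> 'rV[R]_N -> R.
Variable B : torus R N -> 'M[R]_m.
Implicit Types (u v : 'I_m -> torus R N -> R) (a : R) (x y : torus R N).

Definition coupling u x (i : 'I_m) : R := \sum_j B x i j * u j x.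

Definition subsolution a u : Prop :=
  (forall i, continuous (u i)) /\
  forall x i p, superdiff (u i) x p -> H i x p + coupling u x i <= a.

Definition supersolution a u : Prop :=
  (forall i, continuous (u i)) /\
  forall x i p, subdiff (u i) x p -> a <= H i x p + coupling u x i.

Definition solution a u : Prop := subsolution a u /\ supersolution a u.

(* Taken in the extended reals, so that [critical_value = 0] cannot hold by
   the default value of [inf] on empty or unbounded sets. *)
Definition critical_value : \bar R :=
  ereal_inf [set a%:E | a in [set a : R | exists u, subsolution a u]].

(* For convex Hamiltonians, irreducible degenerate couplings and critical
   value 0, the set below is nonempty and bounded above, so the default value
   of [sup] plays no role. *)
Definition Phi (i j : 'I_m) y x : R :=
  sup [set v i x - v j y | v in subsolution 0].

Definition aubry (j : 'I_m) : set (torus R N) :=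
  [set y | solution 0 (fun i x => Phi i j y x)].

End System.

(* Main.v *)
From HB Require Import structures.
Require Import Defs.
From mathcomp Require Import all_boot all_order all_algebra.
From mathcomp Require Import generic_quotient.
From mathcomp Require Import finmap.
From mathcomp Require Import all_classical all_reals all_analysis.
From mathcomp Require Import ring lra.
Set Implicit Arguments.
Unset Strict Implicit.
Unset Printing Implicit Defensive.
Import Order.TTheory GRing.Theory Num.Theory.
Import numFieldNormedType.Exports.
Local Open Scope classical_set_scope.
Local Open Scope ring_scope.

(** The proof is a maximum principle in which the strictness comes from the
    complement of the Aubry set.

    Maximum principle (max_all_components). Let w be a subsolution and u a
    supersolution, and let the maximum M of w_i - u_i over all components and
    points be attained at x by component i. Doubling of variables gives
    (B(x)(w - u)(x))_i <= 0. Since the rows of B(x) sum to zero, the left side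
    equals the sum of b_ij(x)(w_j - u_j - M)(x), whose terms are all
    nonnegative; hence every j with b_ij(x) <> 0 also attains M at x, and
    irreducibility spreads this to all components. If w_i satisfies its
    inequality with a margin theta_i, the same computation shows
    theta_i(x) = 0.

    Strictness off the Aubry set (strict_off_aubry). The function
    Phi_{.,j}(y,.) is the largest critical subsolution whose component j
    vanishes at y. Wherever it fails to be a supersolution it can be raised in
    one component near the point of failure (bump), and the raised function
    has a positive margin there. By maximality the failure can only occur in
    component j at y itself. So a point y outside the Aubry set carries a
    critical subsolution whose component j has a positive margin at y.

    Conclusion (comparison_on_aubry). Suppose the maximum M of v - u is
    positive. All components attain M together, so the set K where M is
    attained is disjoint from the Aubry set. Averaging finitely many
    subsolutions from the previous step gives one, w, with a positive margin in
    component j on all of K. For small t the maximum of (1 - t) v + t w - u is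
    attained by all components together, and at points where component j of
    v - u is close to M; there the margin t theta_j is positive, which
    contradicts the maximum principle.

    The viscosity part rests on one tool, the fuzzy sum rule (fuzzy_sum): a
    superdifferential of f + g is approximated by sums of superdifferentials of
    f and g at nearby points. It yields the comparison of a subsolution with a
    supersolution, the stability of subsolutions under convex combinations and
    the Lipschitz bound. That Phi is finite, continuous and a subsolution
    needs bounds that are uniform over all critical subsolutions: the coupling
    terms are bounded above because the Hamiltonians are bounded below,
    irreducibility turns this into a bound on the differences of components
    (row_gap), and coercivity then gives a common Lipschitz constant. *)

(** * Test functions and superdifferentials *)

Section TestFunctions.
Variables (R : realType) (N : nat).
Local Notation V := 'rV[R]_N.
Implicit Types (f phi psi : V -> R) (z a p q h : V).

(** The slopes p with [touch_above f z p] form the superdifferential of f at z.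
    Subdifferentials are obtained from it by changing the signs of f and p. *)
Definition touch_above f z p : Prop :=
  exists phi, [/\ C1_near phi z, grad phi z = p
    & \forall z' \near z, f z' - phi z' <= f z - phi z].

Definition dotr p h : R := \sum_i p ord0 i * h ord0 i.

Lemma C1_near_nbhs phi z : C1_near phi z -> \forall z' \near z, C1_near phi z'.
Proof. by move=> h; apply/near_join. Qed.

Lemma C1_near_diff phi z : C1_near phi z -> differentiable phi z.
Proof. by move=> /nbhs_singleton[]. Qed.

Lemma gradD phi psi z : differentiable phi z -> differentiable psi z ->
  grad (phi \+ psi) z = grad phi z + grad psi z.
Proof.
by move=> dp dq; apply/rowP => i; rewrite !mxE deriveD//; exact: diff_derivable.
Qed.

Lemma gradZ (c : R) phi z : differentiable phi z ->
  grad (c \*: phi) z = c *: grad phi z.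
Proof.
by move=> dp; apply/rowP => i; rewrite !mxE deriveZ//; exact: diff_derivable.
Qed.

Lemma C1_near_nbhs2 phi psi z : C1_near phi z -> C1_near psi z ->
  \forall y \near z, C1_near phi y /\ C1_near psi y.
Proof.
by move=> /C1_near_nbhs cp /C1_near_nbhs cq; have h := filterI cp cq; exact: h.
Qed.

Lemma C1_nearD phi psi z : C1_near phi z -> C1_near psi z ->
  C1_near (phi \+ psi) z.
Proof.
move=> cp cq; have cpq := C1_near_nbhs2 cp cq; rewrite /C1_near.
apply: (filterS _ cpq) => y [cpy cqy].
split; first by apply: differentiableD; exact: C1_near_diff.
have [_ gp] := nbhs_singleton cpy; have [_ gq] := nbhs_singleton cqy.
rewrite /prop_for /continuous_at gradD; [|exact: C1_near_diff..].
have cpqy := C1_near_nbhs2 cpy cqy.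
have E : {near nbhs y, (grad phi \+ grad psi) =1 grad (phi \+ psi)}.
  by apply: filterS cpqy => t [ct dt]; rewrite gradD//; exact: C1_near_diff.
exact: cvg_trans (near_eq_cvg E) (cvgD gp gq).
Qed.

Lemma C1_nearZ (c : R) phi z : C1_near phi z -> C1_near (c \*: phi) z.
Proof.
move=> cp; have cp' := C1_near_nbhs cp; rewrite /C1_near.
apply: (filterS _ cp') => y cpy.
split; first by apply: differentiableZ; exact: C1_near_diff.
have [_ gp] := nbhs_singleton cpy.
rewrite /prop_for /continuous_at gradZ; [|exact: C1_near_diff..].
have cpy' := C1_near_nbhs cpy.
have E : {near nbhs y, c \*: grad phi =1 grad (c \*: phi)}.
  by apply: filterS cpy' => t ct; rewrite gradZ//; exact: C1_near_diff.
exact: cvg_trans (near_eq_cvg E) (cvgZl_tmp (k:=c) gp).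
Qed.

Definition sqdist a z : R := \sum_i (z ord0 i - a ord0 i) ^+ 2.

Lemma is_diff_coord z i :
  is_diff z (fun y : V => y ord0 i : R) (fun h : V => h ord0 i).
Proof.
have lg : linear (fun y : V => y ord0 i : R) by move=> k x y; rewrite !mxE.
pose gl : {linear V -> R} := HB.pack (fun y : V => y ord0 i : R)
  (GRing.isLinear.Build _ _ _ _ _ lg).
have cg : continuous gl by exact: coord_continuous.
have -> : (fun y : V => y ord0 i) = gl by [].
by apply: DiffDef; [exact: linear_differentiable|rewrite diff_lin].
Qed.

Let coordB a (i : 'I_N) : V -> R := fun y => y ord0 i - a ord0 i.

Let coordB_diff a i z : differentiable (coordB a i) z.
Proof.
apply: differentiableB; last exact: differentiable_cst.
exact: differentiable_coord.
Qed.

Let sqdistE a : sqdist a = \sum_(i < N) (coordB a i) ^+ 2.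
Proof. by apply/funext => y; rewrite fct_sumE. Qed.

Lemma sqdist_differentiable a z : differentiable (sqdist a) z.
Proof.
by rewrite sqdistE; apply: differentiable_sum => i; exact: differentiableX.
Qed.

Lemma grad_sqdist a z : grad (sqdist a) z = 2 *: (z - a).
Proof.
have dc k v : derivable (coordB a k) z v by exact/diff_derivable.
apply/rowP => i; rewrite sqdistE !mxE derive_sum; last first.
  by move=> k; exact: derivableX.
have dE k : 'D_(delta_mx 0 i) ((coordB a k) ^+ 2) z
    = 2 * (z ord0 k - a ord0 k) * (k == i)%:R.
  rewrite deriveX; last exact/diff_derivable.
  rewrite deriveB; [|exact/diff_derivable/differentiable_coord|
    exact: derivable_cst].
  rewrite derive_cst subr0 deriveE; last exact: differentiable_coord.
  have [_ ->] := is_diff_coord z k; rewrite mxE eqxx /= expr1.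
  by rewrite /GRing.scale/= mulr_natl.
rewrite (eq_bigr _ (fun k _ => dE k)) (bigD1 i)//= eqxx mulr1 big1 ?addr0//.
by move=> k /negPf ->; rewrite mulr0.
Qed.

Lemma C1_near_sqdist a z : C1_near (sqdist a) z.
Proof.
near=> y; split; first exact: sqdist_differentiable.
have -> : grad (sqdist a) = (fun y => 2 *: (y - a)).
  by apply/funext => t; exact: grad_sqdist.
apply: (@continuousZl_tmp _ _ _ (id \- cst a) 2).
by apply: continuousB; [move=> ?; exact: id|exact: cst_continuous].
Unshelve. all: by end_near. Qed.

Lemma C1_near_grad_cvg phi z : C1_near phi z -> grad phi y @[y --> z] --> grad phi z.
Proof. by move=> /nbhs_singleton[]. Qed.

Lemma derive_grad phi z h : differentiable phi z -> 'D_h phi z = dotr (grad phi z) h.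
Proof.
move=> dp; rewrite deriveE// {1}(row_sum_delta h) linear_sum; apply: eq_bigr => i _.
by rewrite linearZ /= mxE deriveE// mulrC.
Qed.

(** A growth rate of f at z in a direction h bounds the slope of every test
    function touching f from above, because the test function grows at least as
    fast. *)
Lemma touch_above_dot f z q h (s e : R) : touch_above f z q -> 0 < e ->
  (forall t, 0 < t < e -> f z + t * s <= f (z + t *: h)) -> s <= dotr q h.
Proof.
move=> [phi [cphi gq tch]] e0 H.
have dp := C1_near_diff cphi.
rewrite -gq -derive_grad//.
have dd : derivable phi z h by exact: diff_derivable.
have cv : t^-1 *: (phi (t *: h + z) - phi z) @[t --> 0^'+] --> 'D_h phi z.
  exact: (cvg_dnbhs_at_right dd).
have zt : (z + t *: h) @[t --> 0^'+] --> z.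
  have : (z + t *: h) @[t --> 0^'+] --> z + (0 : R) *: h.
    apply: (@cvgD _ _ _ (at_right 0) _ (cst z)); first exact: cvg_cst.
    by apply: cvgZr_tmp; apply: cvg_at_right_filter; exact: cvg_id.
  by rewrite scale0r addr0.
apply: (cvgr_to_ge cv).
near=> t.
have t0 : 0 < t by near: t; exact: nbhs_right_gt.
rewrite /GRing.scale/= ler_pdivlMl// (addrC _ z).
have {}H := H t; rewrite t0/= in H.
have /H {}H : t < e by near: t; exact: nbhs_right_lt.
suff : f (z + t *: h) - phi (z + t *: h) <= f z - phi z.
  by lra.
near: t; exact: (zt _ tch).
Unshelve. all: by end_near. Qed.

End TestFunctions.

(** * Compactness *)

Section Compactness.
Variable R : realType.
Implicit Type X : normedModType R.

Lemma near_normP X (x : X) (P : X -> Prop) :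
  (\forall y \near x, P y) <->
  exists2 d : R, 0 < d & forall y, `|y - x| < d -> P y.
Proof.
rewrite nbhs_normP; split=> -[d d0 H]; exists d => // y /=.
  by move=> yx; apply: H => /=; rewrite distrC.
by rewrite distrC; apply: H.
Qed.

Lemma continuous_normP X (Y : normedModType R) (F : X -> Y) x : {for x, continuous F} ->
  forall e : R, 0 < e ->
  exists2 d : R, 0 < d & forall y, `|y - x| < d -> `|F y - F x| < e.
Proof.
move=> cF e e0; apply/(near_normP x).
move/cvgrPdist_lt : cF => /(_ _ e0).
by apply: filterS => y; rewrite distrC.
Qed.

Lemma normP_continuous X (Y : normedModType R) (F : X -> Y) x :
  (forall e : R, 0 < e ->
  exists2 d : R, 0 < d & forall y, `|y - x| < d -> `|F y - F x| < e) ->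
  {for x, continuous F}.
Proof.
move=> H; apply/cvgrPdist_lt => e e0.
have := (near_normP x _).2 (H e e0).
by apply: filterS => y; rewrite distrC.
Qed.

(** The second point ranges beyond K, so that K may be a thin set such as the
    product of a point and a ball. The proof is the filter form of compactness,
    applied to a radius tending to 0 from the right. *)
Lemma compact_uniform X (K : set X) (F : X -> R) : compact K ->
  (forall x, K x -> {for x, continuous F}) -> forall e : R, 0 < e ->
  exists2 d : R, 0 < d &
    forall x y, K x -> `|y - x| < d -> `|F y - F x| < e.
Proof.
move=> /compact_near_coveringP cK cF e e0.
pose P (d : R) (x : X) := forall y, `|y - x| < d -> `|F y - F x| < e.
have /(cK _ _ _ (at_right_proper_filter (0 : R))) H : forall x, K x ->
    \forall x' \near x & d \near 0^'+, P d x'.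
  move=> x Kx.
  have [d d0 Fd] := continuous_normP (cF x Kx) (divr_gt0 e0 (ltr0n _ 2)).
  have d20 : 0 < d / 2 by rewrite divr_gt0.
  exists ([set x' | `|x' - x| < d / 2], [set t | t < d / 2]).
    by split; [apply/near_normP; exists (d / 2)|exact: nbhs_right_lt].
  move=> [x' t] /= [x'x td] y yx'.
  have yx : `|y - x| < d.
    rewrite (splitr d) (le_lt_trans (ler_distD x' _ _))// ltrD//.
    exact: lt_trans td.
  have x'd : `|x' - x| < d by move: x'x; lra.
  rewrite (splitr e) (le_lt_trans (ler_distD (F x) _ _))// ltrD//.
    exact: Fd.
  by rewrite distrC; exact: Fd.
near (0 : R)^'+ => d; exists d; first by near: d; exact: nbhs_right_gt.
have Kd : K `<=` P d by near: d.
by move=> x y /Kd; apply.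
Unshelve. all: by end_near. Qed.

Lemma compact_max X (K : set X) (F : X -> R) (x0 : X) : compact K -> K x0 ->
  (forall x, K x -> {for x, continuous F}) ->
  exists2 c, K c & forall x, K x -> F x <= F c.
Proof.
move=> cK K0 cF.
have [| |c] := @compact_EVT_max X R F K _ cK.
- by exists x0.
- by apply: continuous_in_subspaceT => x /[!inE]; exact: cF.
- by rewrite inE => Kc H; exists c => // x Kx; apply: H; rewrite inE.
Qed.

Definition cball X (a : X) (r : R) : set X := [set y | `|y - a| <= r].

Lemma compact_cball N (a : 'rV[R]_N) r : compact (cball a r).
Proof.
apply: bounded_closed_compact.
  exists (r + `|a|); split; first exact: num_real.
  move=> M rM y; rewrite /cball/= => ya.
  rewrite -(subrK a y) (le_trans (ler_normD _ _))// (le_trans _ (ltW rM))//.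
  by rewrite lerD2r.
rewrite (_ : cball a r = (fun y => `|y - a|) @^-1` [set t | t <= r])//.
apply: closed_comp; last exact: closed_le.
move=> x _; apply: normP_continuous => e e0; exists e => // y yx.
rewrite (le_lt_trans _ yx)//.
have -> : y - x = (y - a) - (x - a) by rewrite opprB addrA subrK.
exact: ler_dist_dist.
Qed.

End Compactness.

Lemma continuous_fst (X Y Z : topologicalType) (h : X -> Z) x (y : Y) :
  {for x, continuous h} -> {for (x, y), continuous (fun xy : X * Y => h xy.1)}.
Proof.
by move=> ch; apply: (@continuous_comp _ _ _ fst h) => //; exact: cvg_fst.
Qed.

Lemma continuous_snd (X Y Z : topologicalType) (h : Y -> Z) (x : X) y :
  {for y, continuous h} -> {for (x, y), continuous (fun xy : X * Y => h xy.2)}.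
Proof.
by move=> ch; apply: (@continuous_comp _ _ _ snd h) => //; exact: cvg_snd.
Qed.

(** * The fuzzy sum rule *)

Section FuzzySum.
Variables (R : realType) (N : nat).
Local Notation V := 'rV[R]_N.
Implicit Types (f g phi psi : V -> R) (z a p q h : V).

Lemma coord_le_norm h i : `|h ord0 i| <= `|h|.
Proof.
rewrite [leRHS]/Num.Def.normr /= mx_normrE.
by apply/bigmax_geP; right => /=; exists (ord0, i).
Qed.

(** [sqdist] is the Euclidean square, which is smooth; the norm on row vectors
    is the sup norm, which is dominated by the Euclidean one. *)
Lemma sqdist_ge a z : `|z - a| ^+ 2 <= sqdist a z.
Proof.
have s0 : 0 <= sqdist a z by apply: sumr_ge0 => i _; exact: sqr_ge0.
have [->|n0] := eqVneq `|z - a| 0; first by rewrite expr0n.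
have [[i j]] := mx_norm_neq0 n0.
rewrite -[mx_norm _]/(`|z - a|) => -> /=; rewrite ord1 !mxE real_normK ?num_real//.
by rewrite /sqdist (bigD1 j)//= lerDl sumr_ge0// => k _; exact: sqr_ge0.
Qed.

Lemma sqdist_ge0 a z : 0 <= sqdist a z.
Proof. by rewrite (le_trans _ (sqdist_ge a z))// sqr_ge0. Qed.

Lemma sqdistxx a : sqdist a a = 0.
Proof. by apply: big1 => i _; rewrite subrr expr0n. Qed.

Lemma sqdistC a z : sqdist a z = sqdist z a.
Proof. by apply: eq_bigr => i _; rewrite -sqrrN opprB. Qed.

Lemma norm_lt_sqdist a z (r : R) : 0 < r -> sqdist a z < r ^+ 2 -> `|z - a| < r.
Proof.
move=> r0 H; rewrite ltNge; apply/negP => rz.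
have : r ^+ 2 <= sqdist a z.
  by rewrite (le_trans _ (sqdist_ge a z))// lerXn2r ?nnegrE ?normr_ge0// ltW.
by rewrite leNgt H.
Qed.

Lemma sqdist_continuous a : continuous (sqdist a).
Proof. by move=> z; apply: differentiable_continuous; exact: sqdist_differentiable. Qed.

Lemma sqdist_continuous2 : continuous (fun xy : V * V => sqdist xy.2 xy.1).
Proof.
have -> : (fun xy : V * V => sqdist xy.2 xy.1) = (sqdist 0 \o (fun xy => xy.1 - xy.2)).
  apply/funext => xy; rewrite /sqdist/=.
  by apply: eq_bigr => i _; rewrite !mxE subr0.
move=> xy; apply: continuous_comp; last exact: sqdist_continuous.
by apply: (@cvgB _ _ _ (nbhs xy)); [exact: cvg_fst|exact: cvg_snd].
Qed.

Lemma C1_near_cball phi z0 (e : R) : C1_near phi z0 -> 0 < e ->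
  exists2 r : R, 0 < r & forall z, `|z - z0| <= r ->
    C1_near phi z /\ `|grad phi z - grad phi z0| < e.
Proof.
move=> cphi e0.
have [d1 d10 H1] := (near_normP z0 _).1 (C1_near_nbhs cphi).
have [d2 d20 H2] := continuous_normP (C1_near_grad_cvg cphi) e0.
exists (Num.min d1 d2 / 2) => [|z zr]; first by rewrite divr_gt0// lt_min d10.
have : `|z - z0| < Num.min d1 d2.
  by rewrite (le_lt_trans zr)// ltr_pdivrMr// ltr_pMr ?lt_min ?d10// ltr1n.
by rewrite lt_min => /andP[h1 h2]; split; [exact: H1|exact: H2].
Qed.

(** Doubling of variables: f x + g y - phi x - |x - z0|^2 - k |x - y|^2 is
    maximized over a product of balls. A large k forces x and y together, the
    term |x - z0|^2 then forces both to z0, and the gradients of the penalty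
    k |x - y|^2 in x and in y cancel in the sum P + Q. *)
Lemma fuzzy_sum f g phi z0 : continuous f -> continuous g -> C1_near phi z0 ->
  (\forall z \near z0, f z + g z - phi z <= f z0 + g z0 - phi z0) ->
  forall e : R, 0 < e -> exists x y P Q,
    [/\ `|x - z0| < e, `|y - z0| < e, touch_above f x P, touch_above g y Q
      & `|P + Q - grad phi z0| < e].
Proof.
move=> cf cg cphi /near_normP[d0 d0_gt0 loc] e e0.
have e20 : 0 < e / 2 by rewrite divr_gt0.
have [r0 r0_gt0 near_grad] := C1_near_cball cphi e20.
pose r := Num.min (Num.min r0 (d0 / 2)) (e / 2).
have r_gt0 : 0 < r by rewrite !lt_min r0_gt0 e20 divr_gt0.
have rr0 : r <= r0 by rewrite !ge_min lexx.
have rd0 : r < d0.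
  have : r <= d0 / 2 by rewrite !ge_min lexx orbT.
  lra.
have re : r <= e / 2 by rewrite !ge_min lexx !orbT.
pose K := cball z0 r.
have Kz0 : K z0 by rewrite /K /cball/= subrr normr0 ltW.
have cK : compact K by exact: compact_cball.
have [M M0 gM] : exists2 M : R, 0 < M & forall x, K x -> `|g x| <= M.
  have [c Kc H] : exists2 c, K c & forall x, K x -> `|g x| <= `|g c|.
    apply: (@compact_max _ _ _ (fun x => `|g x|) z0) => // x _.
    by apply: (@continuous_comp _ _ _ g (fun t : R => `|t|)); [exact: cg|exact: norm_continuous].
  exists (`|g c| + 1) => [|x Kx]; first by rewrite ltr_wpDl.
  by rewrite (le_trans (H x Kx))// lerDl.
have r20 : 0 < r / 2 by rewrite divr_gt0.
have [d1 d1_gt0 unifg] := compact_uniform cK (fun x _ => cg x) (exprn_gt0 2 r20).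
pose d := Num.min d1 (r / 2).
have d_gt0 : 0 < d by rewrite lt_min d1_gt0.
(* k is chosen so large that the doubled maximum has |x - y| < d: its penalty
   is bounded by the oscillation 2 M of g on K. *)
pose k := (2 * M + 1) / d ^+ 2.
have k_gt0 : 0 < k by rewrite divr_gt0 ?exprn_gt0// addr_gt0// mulr_gt0.
pose E (xy : V * V) :=
  f xy.1 + g xy.2 - phi xy.1 - sqdist z0 xy.1 - k * sqdist xy.2 xy.1.
have cE xy : (K `*` K) xy -> {for xy, continuous E}.
  case: xy => x y [/= Kx Ky].
  have cphix : {for x, continuous phi}.
    apply: differentiable_continuous; apply: C1_near_diff.
    by have [] := near_grad x (le_trans Kx rr0).
  have c1 := continuousD (continuous_fst (y := y) (cf x)) (continuous_snd (x := x) (cg y)).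
  have c2 := continuousB c1 (continuous_fst (y := y) cphix).
  have c3 := continuousB c2 (continuous_fst (y := y) (sqdist_continuous (a := z0) (x := x))).
  have c4 := continuousZl_tmp (k := k) (sqdist_continuous2 (x := (x, y))).
  exact: continuousB c3 c4.
have [[x y] [/= Kx Ky] maxE] :=
  @compact_max _ _ _ E (z0, z0) (compact_setX cK cK) (conj Kz0 Kz0) cE.
have Kd0 z : K z -> `|z - z0| < d0 by move=> Kz; exact: le_lt_trans Kz rd0.
have E0 := maxE (z0, z0) (conj Kz0 Kz0).
have locx := loc x (Kd0 _ Kx).
have key : k * sqdist y x + sqdist z0 x <= g y - g x.
  by move: E0; rewrite /E /= !sqdistxx; lra.
have xy_d : `|x - y| < d.
  apply: norm_lt_sqdist => //.
  have : k * sqdist y x < 2 * M + 1.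
    have := gM x Kx; have := gM y Ky; have := sqdist_ge0 z0 x.
    rewrite !ler_norml => s0 /andP[h1 h2] /andP[h3 h4]; lra.
  by rewrite /k mulrAC ltr_pdivrMr ?exprn_gt0// ltr_pM2l// addr_gt0// mulr_gt0.
have xz0 : `|x - z0| < r / 2.
  apply: norm_lt_sqdist => //.
  have : `|g y - g x| < (r / 2) ^+ 2.
    apply: unifg => //; rewrite distrC (lt_le_trans xy_d)//.
    by rewrite ge_min lexx.
  have := sqdist_ge0 y x; rewrite ltr_norml => s0 /andP[_].
  have := mulr_ge0 (ltW k_gt0) s0; lra.
have yz0 : `|y - z0| < r.
  rewrite (le_lt_trans (ler_distD x _ _))// (splitr r) addrC ltrD//.
  by rewrite distrC (lt_le_trans xy_d)// ge_min lexx orbT.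
have xr : `|x - z0| < r by lra.
have r_lt_e : r < e by lra.
have nearK z : `|z - z0| < r -> \forall z' \near z, K z'.
  move=> zr; apply/near_normP; exists (r - `|z - z0|); first by rewrite subr_gt0.
  move=> z' zz'; rewrite /K /cball/= (le_trans (ler_distD z _ _))//.
  by lra.
have [cphix gradx] := near_grad x (le_trans Kx rr0).
exists x, y, (grad phi x + 2 *: (x - z0) + k *: (2 *: (x - y))), (k *: (2 *: (y - x))).
split; [exact: lt_trans xr r_lt_e|exact: lt_trans yz0 r_lt_e| | |].
- exists ((phi \+ sqdist z0) \+ k \*: sqdist y); split.
  + exact: C1_nearD (C1_nearD cphix (C1_near_sqdist _ _))
      (C1_nearZ _ (C1_near_sqdist _ _)).
  + have ds a : differentiable (sqdist a) x by exact: sqdist_differentiable.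
    rewrite gradD//; [|exact: differentiableD (C1_near_diff cphix) _|exact: differentiableZ].
    by rewrite gradD ?gradZ ?grad_sqdist//; exact: C1_near_diff.
  + apply: filterS (nearK x xr) => x' Kx'.
    have := maxE (x', y) (conj Kx' Ky); rewrite /E /= /GRing.scale /=; lra.
- exists (k \*: sqdist x); split.
  + exact: C1_nearZ _ (C1_near_sqdist _ _).
  + by rewrite gradZ ?grad_sqdist//; exact: sqdist_differentiable.
  + apply: filterS (nearK y yz0) => y' Ky'.
    have := maxE (x, y') (conj Kx Ky').
    by rewrite /E /= /GRing.scale /= (sqdistC y) (sqdistC y'); lra.
- have -> : grad phi x + 2 *: (x - z0) + k *: (2 *: (x - y)) + k *: (2 *: (y - x))
      - grad phi z0 = (grad phi x - grad phi z0) + 2 *: (x - z0).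
    apply/rowP => i; rewrite !mxE; ring.
  rewrite (le_lt_trans (ler_normD _ _))// normrZ ger0_norm//; lra.
Qed.

End FuzzySum.

(** * Scalar Hamilton-Jacobi inequalities *)

Section Scalar.
Variables (R : realType) (N : nat).
Local Notation V := 'rV[R]_N.
Implicit Types (f g v u W phi psi : V -> R) (x y z a p q : V) (h : V -> V -> R).

(** The right-hand side g will contain the coupling terms, so that a system
    becomes a family of scalar inequalities. *)
Definition visc_sub h f g := forall z p, touch_above f z p -> h z p <= g z.

Definition visc_super h u g :=
  forall z p, touch_above (fun y => - u y) z (- p) -> g z <= h z p.

(** Coercivity enters only through the boundedness of the sublevels,
    uniformly in the position. *)
Definition coercive_ham h := [/\ continuous (fun zp : V * V => h zp.1 zp.2),
  forall z p q (s t : R), 0 < s -> 0 < t -> s + t = 1 ->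
    h z (s *: p + t *: q) <= s * h z p + t * h z q
  & forall K : R, exists L : R, forall z p, h z p <= K -> `|p| <= L].

Lemma coercive_ham_unif h z0 (L e : R) : coercive_ham h -> 0 < e ->
  exists2 d : R, 0 < d & forall z p q,
    `|p| <= L -> `|z - z0| < d -> `|q - p| < d -> `|h z q - h z0 p| < e.
Proof.
move=> [ch _ _] e0.
have cK : compact ([set z0] `*` cball (0 : V) L).
  by apply: compact_setX; [exact: compact_set1|exact: compact_cball].
have [d d0 H] := @compact_uniform R (V * V)%type _ (fun zp : V * V => h zp.1 zp.2) cK
  (fun (zp : V * V) _ => ch zp) e e0.
exists d => // z p q pL zd qd.
apply: (H (z0, p) (z, q)); first by split=> //=; rewrite /cball/= subr0.
by rewrite prod_normE/= gt_max zd.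
Qed.

Lemma continuous_common_ball f g z0 (e d : R) : continuous f -> continuous g ->
  0 < e -> 0 < d -> exists2 r : R, 0 < r & r <= d /\ forall z, `|z - z0| < r ->
    `|f z - f z0| < e /\ `|g z - g z0| < e.
Proof.
move=> cf cg e0 d0.
have [d1 d10 H1] := continuous_normP (cf z0) e0.
have [d2 d20 H2] := continuous_normP (cg z0) e0.
exists (Num.min d (Num.min d1 d2)); first by rewrite !lt_min d0 d10.
split=> [|z]; first by rewrite ge_min lexx.
by rewrite !lt_min => /and3P[_ /H1 ? /H2].
Qed.

Lemma touch_aboveZ f z p (s : R) : 0 < s ->
  touch_above (fun y => s * f y) z p -> touch_above f z (s^-1 *: p).
Proof.
move=> s0 [phi [c1 gp tch]]; exists (s^-1 \*: phi); split.
- exact: C1_nearZ.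
- by rewrite gradZ ?gp//; exact: C1_near_diff.
- move: tch; apply: filterS => y; rewrite /= /GRing.scale/= => H.
  rewrite -(ler_pM2l s0) !mulrBr !mulrA divff ?gt_eqF// !mul1r; exact: H.
Qed.

(** The fuzzy sum rule splits a slope of the combination into slopes p1, p2 of
    the two functions at nearby points, up to a small error; these are bounded
    by coercivity, so the Hamiltonian is uniformly continuous along them and
    its convexity in p concludes. *)
Lemma visc_sub_convex h f1 f2 g1 g2 (s t : R) : coercive_ham h ->
  continuous f1 -> continuous f2 -> continuous g1 -> continuous g2 ->
  0 < s -> 0 < t -> s + t = 1 ->
  visc_sub h f1 g1 -> visc_sub h f2 g2 ->
  visc_sub h (fun z => s * f1 z + t * f2 z) (fun z => s * g1 z + t * g2 z).
Proof.
move=> hh cf1 cf2 cg1 cg2 s0 t0 st1 sub1 sub2 z0 p [phi [cphi gp tch]].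
apply/ler_addgt0Pr => e e0.
have e40 : 0 < e / 4 by rewrite divr_gt0.
have [_ cvx coer] := hh.
have [L HL] := coer (Num.max (g1 z0) (g2 z0) + e).
have [d d0 Hd] := coercive_ham_unif z0 L hh e40.
have [r r0 [rd Hr]] := continuous_common_ball z0 cg1 cg2 e40 d0.
have csf1 : continuous (fun z => s * f1 z).
  by move=> z; exact: (continuousZl_tmp (k := s) (cf1 z)).
have ctf2 : continuous (fun z => t * f2 z).
  by move=> z; exact: (continuousZl_tmp (k := t) (cf2 z)).
have [x [y [P [Q [xr yr /(touch_aboveZ s0) tP /(touch_aboveZ t0) tQ PQ]]]]] :=
  fuzzy_sum csf1 ctf2 cphi tch r0.
set p1 := s^-1 *: P in tP; set p2 := t^-1 *: Q in tQ.
have PE : P = s *: p1 by rewrite scalerA divff ?gt_eqF// scale1r.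
have QE : Q = t *: p2 by rewrite scalerA divff ?gt_eqF// scale1r.
clearbody p1 p2.
have [/ltr_normlP[_ g1x] _] := Hr x xr; have [_ /ltr_normlP[_ g2y]] := Hr y yr.
have h1 := sub1 _ _ tP; have h2 := sub2 _ _ tQ.
have p1L : `|p1| <= L.
  apply: (HL x); rewrite (le_trans h1)//.
  have : g1 z0 <= Num.max (g1 z0) (g2 z0) by rewrite le_max lexx.
  lra.
have p2L : `|p2| <= L.
  apply: (HL y); rewrite (le_trans h2)//.
  have : g2 z0 <= Num.max (g1 z0) (g2 z0) by rewrite le_max lexx orbT.
  lra.
have /ltr_normlP[h1' _] : `|h x p1 - h z0 p1| < e / 4.
  by apply: Hd => //; [exact: lt_le_trans xr rd|rewrite subrr normr0].
have /ltr_normlP[h2' _] : `|h y p2 - h z0 p2| < e / 4.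
  by apply: Hd => //; [exact: lt_le_trans yr rd|rewrite subrr normr0].
have /ltr_normlP[_ h0] : `|h z0 p - h z0 (s *: p1 + t *: p2)| < e / 4.
  apply: Hd; last 2 first.
  - by rewrite subrr normr0.
  - by rewrite -PE -QE -gp distrC (lt_le_trans PQ rd).
  rewrite (le_trans (ler_normD _ _))// !normrZ (gtr0_norm s0) (gtr0_norm t0).
  by rewrite -[leRHS]mul1r -st1 mulrDl lerD//; rewrite ler_pM2l.
have := cvx z0 p1 p2 s t s0 t0 st1.
have H1 : s * h z0 p1 <= s * (g1 z0 + e / 2) by rewrite ler_pM2l//; lra.
have H2 : t * h z0 p2 <= t * (g2 z0 + e / 2) by rewrite ler_pM2l//; lra.
have : s * (e / 2) + t * (e / 2) = e / 2 by rewrite -mulrDl st1 mul1r.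
lra.
Qed.

(** The fuzzy sum rule applied to v and - u with the zero test function
    yields nearly equal slopes of v and u at nearby points. *)
Lemma visc_comparison h v u g g' z0 : coercive_ham h ->
  continuous v -> continuous u -> continuous g -> continuous g' ->
  visc_sub h v g -> visc_super h u g' ->
  (\forall z \near z0, v z - u z <= v z0 - u z0) -> g' z0 <= g z0.
Proof.
move=> hh cv cu cg cg' sub sup locmax.
apply/ler_addgt0Pr => e e0.
have e40 : 0 < e / 4 by rewrite divr_gt0.
have [_ _ coer] := hh.
have [L HL] := coer (g z0 + e).
have [d d0 Hd] := coercive_ham_unif z0 L hh e40.
have [r r0 [rd Hr]] := continuous_common_ball z0 cg cg' e40 d0.
have cnu : continuous (fun z => - u z) by move=> z; exact: continuousN (cu z).
pose phi := (0 : R) \*: sqdist z0.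
have cphi : C1_near phi z0 by exact: C1_nearZ _ (C1_near_sqdist _ _).
have gphi : grad phi z0 = 0.
  by rewrite gradZ ?scale0r//; exact: sqdist_differentiable.
have loc : \forall z \near z0, v z + (- u z) - phi z <= v z0 + (- u z0) - phi z0.
  by move: locmax; apply: filterS => z; rewrite /phi/= !scale0r !subr0.
have [x [y [P [Q [xr yr tP tQ]]]]] := fuzzy_sum cv cnu cphi loc r0.
rewrite gphi subr0 => PQ.
have [/ltr_normlP[_ gx] _] := Hr x xr; have [_ /ltr_normlP[gy _]] := Hr y yr.
have h1 := sub _ _ tP.
have h2 : g' y <= h y (- Q) by apply: sup; rewrite opprK.
have PL : `|P| <= L by apply: (HL x); lra.
have /ltr_normlP[h1' _] : `|h x P - h z0 P| < e / 4.
  by apply: Hd => //; [exact: lt_le_trans xr rd|rewrite subrr normr0].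
have /ltr_normlP[_ h2'] : `|h y (- Q) - h z0 P| < e / 4.
  apply: Hd => //; first exact: lt_le_trans yr rd.
  by rewrite -opprD normrN addrC (lt_le_trans PQ rd).
lra.
Qed.

Lemma norm_dotr p q : `|dotr p q| <= N%:R * `|p| * `|q|.
Proof.
have -> : N%:R * `|p| * `|q| = \sum_(i < N) `|p| * `|q|.
  by rewrite sumr_const card_ord -mulrA mulr_natl.
rewrite (le_trans (ler_norm_sum _ _ _))// ler_sum// => i _.
by rewrite normrM ler_pM// coord_le_norm.
Qed.

(** Moving from z towards the apex raises the downward cone at rate C, so
    slopes away from the apex are at least of size C; the factor N compares the
    sup norm with its dual norm. *)
Lemma touch_above_cone (C : R) a z q : z != a ->
  touch_above (fun y => - (C * `|y - a|)) z q -> C <= N%:R * `|q|.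
Proof.
move=> za tq.
have n0 : 0 < `|z - a| by rewrite normr_gt0 subr_eq0.
have : C * `|z - a| <= dotr q (a - z).
  apply: (touch_above_dot tq ltr01) => t /andP[t0 t1].
  have -> : z + t *: (a - z) - a = (1 - t) *: (z - a).
    by apply/rowP => i; rewrite !mxE; ring.
  by rewrite normrZ gtr0_norm ?subr_gt0//; lra.
move=> H; rewrite -(ler_pM2r n0) (le_trans H)//.
by rewrite (le_trans (ler_norm _))// (le_trans (norm_dotr _ _))// distrC.
Qed.

(** If f y - C |y - x0| had its maximum at some y <> x0, the fuzzy sum rule
    would produce a slope of f nearly opposite to a slope of the cone, which is
    too steep for the bound L. So the maximum is at x0, which is the
    inequality. Boundedness of f makes the maximum exist. *)
Lemma bounded_touch_lipschitz f (M L : R) : continuous f ->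
  (forall z, `|f z| <= M) -> 0 <= L ->
  (forall z p, touch_above f z p -> `|p| <= L) ->
  forall x y, `|f x - f y| <= (N%:R * L + 1) * `|x - y|.
Proof.
move=> cf fM L0 fL.
have M0 : 0 <= M by exact: le_trans (normr_ge0 _) (fM 0).
suff main x0 y : f y - f x0 <= (N%:R * L + 1) * `|y - x0|.
  move=> x y; rewrite ler_norml -lerN2 opprK opprB andbC main.
  by rewrite distrC main.
set C := N%:R * L + 1.
have C0 : 0 < C by rewrite ltr_wpDl// mulr_ge0.
pose r := (2 * M + 1) / C.
have r0 : 0 < r by rewrite divr_gt0// ltr_wpDl// mulr_ge0.
have Cr : C * r = 2 * M + 1 by rewrite mulrC divfK// gt_eqF.
pose g y : R := - (C * `|y - x0|).
have cg : continuous g.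
  move=> z; apply: normP_continuous => e e0; exists (e / C); first by rewrite divr_gt0.
  move=> z' zz'.
  have -> : g z' - g z = - (C * (`|z' - x0| - `|z - x0|)) by rewrite /g; ring.
  rewrite normrN normrM gtr0_norm// mulrC -ltr_pdivlMr// (le_lt_trans _ zz')//.
  have -> : z' - z = (z' - x0) - (z - x0) by rewrite opprB addrA subrK.
  exact: ler_dist_dist.
have cfg : forall z, cball x0 r z -> {for z, continuous (f \+ g)}.
  by move=> z _; exact: continuousD (cf z) (cg z).
have [|z zr zmax] := @compact_max R V _ (f \+ g) x0 (compact_cball (a := x0) (r := r)) _ cfg.
  by rewrite /cball/= subrr normr0 ltW.
have g0 : g x0 = 0 by rewrite /g subrr normr0 mulr0 oppr0.
have zmax0 : f x0 <= f z + g z.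
  have := zmax x0; rewrite /= g0 addr0; apply.
  by rewrite /cball/= subrr normr0 ltW.
have fMM a b : f a - f b <= 2 * M.
  have := fM a; have := fM b; rewrite !ler_norml => /andP[? ?] /andP[? ?]; lra.
have [zx0|zx0] := eqVneq z x0.
  have [yr|yr] := leP `|y - x0| r.
    by have := zmax y yr; rewrite /= zx0 g0 /g; lra.
  have : C * r < C * `|y - x0| by rewrite ltr_pM2l.
  by rewrite Cr; have := fMM y x0; lra.
exfalso.
have zrr : `|z - x0| < r.
  rewrite -(ltr_pM2l C0) Cr; have := fMM z x0; move: zmax0; rewrite /g; lra.
have n0 : 0 < `|z - x0| by rewrite normr_gt0 subr_eq0.
pose phi := (0 : R) \*: sqdist z.
have cphi : C1_near phi z by exact: C1_nearZ _ (C1_near_sqdist _ _).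
have gphi : grad phi z = 0.
  by rewrite gradZ ?scale0r//; exact: sqdist_differentiable.
have loc : \forall z' \near z, f z' + g z' - phi z' <= f z + g z - phi z.
  apply/near_normP; exists (r - `|z - x0|); first by rewrite subr_gt0.
  move=> z' zz'; rewrite /phi/= !scale0r !subr0; apply: zmax.
  by rewrite /cball/= (le_trans (ler_distD z _ _))//; lra.
have [w w0 Nw] : exists2 w : R, 0 < w & N%:R * w < 1.
  exists (N.+1%:R)^-1; first by rewrite invr_gt0.
  by rewrite ltr_pdivrMr// mul1r ltr_nat.
have e0 : 0 < Num.min `|z - x0| w by rewrite lt_min n0.
have [a [b [P [Q [_ bz tP tQ]]]]] := fuzzy_sum cf cg cphi loc e0.
rewrite gphi subr0 => PQ.
have bx0 : b != x0.
  apply: contraTneq bz => ->; rewrite -leNgt ge_min distrC lexx //.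
have := touch_above_cone bx0 tQ.
have QP : `|Q| <= `|P| + `|P + Q|.
  by rewrite -{1}(addKr P Q) (le_trans (ler_normD _ _))// normrN.
have PL := fL _ _ tP.
have PQN : `|P + Q| < w by rewrite (lt_le_trans PQ)// ge_min lexx orbT.
have : N%:R * `|Q| <= N%:R * (L + w).
  by rewrite ler_wpM2l// (le_trans QP)// lerD// ltW.
rewrite /C; lra.
Qed.

(** A steep enough paraboloid centred at z0 touches f from above near z0. *)
Lemma touch_above_dense f z0 (e : R) : continuous f -> 0 < e ->
  exists x p, `|x - z0| < e /\ touch_above f x p.
Proof.
move=> cf e0.
have r0 : 0 < e / 2 by rewrite divr_gt0.
set r := e / 2 in r0.
have K0 : cball z0 r z0 by rewrite /cball/= subrr normr0 ltW.
have [c Kc H] := @compact_max R V _ f z0 (compact_cball (a := z0) (r := r)) K0 (fun x _ => cf x).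
pose k := (f c - f z0 + 1) / r ^+ 2.
have k0 : 0 < k by rewrite divr_gt0 ?exprn_gt0//; have := H _ K0; lra.
have cE x : cball z0 r x -> {for x, continuous (f - k \*: sqdist z0)}.
  move=> _; have cs := sqdist_continuous (a := z0) (x := x).
  exact: continuousB (cf x) (continuousZl_tmp (k := k) cs).
have [x Kx maxE] := 
  @compact_max R V _ (f - k \*: sqdist z0) z0 (compact_cball (a := z0) (r := r)) K0 cE.
have fx : k * sqdist z0 x <= f c - f z0.
  have := maxE z0 K0; have := H x Kx.
  by rewrite !fctE /= /GRing.scale /= sqdistxx; lra.
have xr : `|x - z0| < r.
  apply: norm_lt_sqdist => //; rewrite -(ltr_pM2l k0) (le_lt_trans fx)//.
  by rewrite /k divfK ?gt_eqF ?exprn_gt0//; lra.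
exists x, (grad (k \*: sqdist z0) x); split; first by rewrite (lt_trans xr)// /r; lra.
exists (k \*: sqdist z0); split=> //; first exact: C1_nearZ _ (C1_near_sqdist _ _).
apply/near_normP; exists (r - `|x - z0|); first by rewrite subr_gt0.
move=> z' zz'; apply: maxE.
by rewrite /cball/= (le_trans (ler_distD x _ _))//; lra.
Qed.

(** W is meant to be the supremum of a family, and v a
    member that almost reaches it at z0. The test function of W, made strict by
    |z - z0|^2, touches v after a small displacement. *)
Lemma touch_above_sup W z0 p (e : R) : continuous W -> touch_above W z0 p ->
  0 < e -> exists2 eta : R, 0 < eta & forall v, continuous v ->
    (forall z, v z <= W z) -> W z0 - eta < v z0 ->
    exists x P, [/\ `|x - z0| < e, `|P - p| < e, W x - v x < e & touch_above v x P].
Proof.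
move=> cW [phi [cphi gp /near_normP[d0 d00 loc]]] e0.
have e20 : 0 < e / 2 by rewrite divr_gt0.
have e80 : 0 < e / 8 by rewrite divr_gt0.
have [d1 d10 Hgrad] := C1_near_cball cphi e20.
have cphi0 : {for z0, continuous phi}.
  by apply: differentiable_continuous; exact: C1_near_diff.
have [d2 d20 Hphi] := continuous_normP cphi0 e80.
have [d3 d30 HW] := continuous_normP (cW z0) e80.
pose m := Num.min d0 (Num.min d1 (Num.min d2 (Num.min d3 (e / 2)))).
have m0 : 0 < m by rewrite !lt_min d00 d10 d20 d30.
pose r := m / 2.
have r0 : 0 < r by rewrite divr_gt0.
have rm : r < m by rewrite /r; lra.
exists (Num.min (r ^+ 2) (e / 8)); first by rewrite lt_min exprn_gt0.
move=> v cv vW; rewrite ltrBlDr => Wv.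
have K0 : cball z0 r z0 by rewrite /cball/= subrr normr0 ltW.
have Km x : cball z0 r x -> [/\ `|x - z0| < d0, `|x - z0| <= d1, `|x - z0| < d2,
    `|x - z0| < d3 & `|x - z0| < e / 2].
  move=> /le_lt_trans/(_ rm); rewrite !lt_min => /and5P[? h ? ? ?].
  by split=> //; exact: ltW.
have cE x : cball z0 r x -> {for x, continuous (v - phi - sqdist z0)}.
  move=> /Km[_ /Hgrad[cx _] _ _ _]; have cs := sqdist_continuous (a := z0) (x := x).
  have cphix : {for x, continuous phi}.
    by apply: differentiable_continuous; exact: C1_near_diff.
  exact: continuousB (continuousB (cv x) cphix) cs.
have [x Kx maxE] := @compact_max R V _ (v - phi - sqdist z0) z0
  (compact_cball (a := z0) (r := r)) K0 cE.
have [xd0 xd1 xd2 xd3 xe] := Km x Kx.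
have E0 := maxE z0 K0; rewrite !fctE sqdistxx in E0.
have Wvr : W z0 < v z0 + r ^+ 2.
  by rewrite (lt_le_trans Wv)// lerD2l ge_min lexx.
have Wve : W z0 < v z0 + e / 8.
  by rewrite (lt_le_trans Wv)// lerD2l ge_min lexx orbT.
have locx := loc x xd0.
have xr : `|x - z0| < r.
  by apply: norm_lt_sqdist => //; have := vW x; lra.
have [cx gx] := Hgrad x xd1.
exists x, (grad phi x + 2 *: (x - z0)); split.
- lra.
- have -> : grad phi x + 2 *: (x - z0) - p = (grad phi x - grad phi z0) + 2 *: (x - z0).
    by rewrite gp addrAC.
  rewrite (le_lt_trans (ler_normD _ _))// normrZ ger0_norm//.
  have : m <= e / 2 by rewrite !ge_min lexx !orbT.
  by move: xr; rewrite /r; lra.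
- have := sqdist_ge0 z0 x; have := Hphi x xd2; have := HW x xd3.
  rewrite !ltr_norml => /andP[? ?] /andP[? ?]; lra.
- exists (phi \+ sqdist z0); split.
  + exact: C1_nearD cx (C1_near_sqdist _ _).
  + by rewrite gradD ?grad_sqdist//; [exact: C1_near_diff|exact: sqdist_differentiable].
  + apply/near_normP; exists (r - `|x - z0|); first by rewrite subr_gt0.
    move=> z' zz'; have := maxE z'; rewrite !fctE /= !opprD !addrA; apply.
    by rewrite /cball/= (le_trans (ler_distD x _ _))//; lra.
Qed.

End Scalar.

(** * Functions on the torus and their lifts *)

Lemma continuous_map_fst (X Y Z : topologicalType) (f : X -> Y) :
  continuous f -> continuous (fun xz : X * Z => (f xz.1, xz.2)).
Proof.
move=> cf [x z]; apply: cvg_pair; last exact: cvg_snd.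
by apply: (@continuous_comp _ _ _ fst f); [exact: cvg_fst|exact: cf].
Qed.

Section TorusLift.
Variables (R : realType) (N : nat).
Local Notation V := 'rV[R]_N.
Local Notation T := (torus R N).
Local Notation pi := (@torus_pi R N).
Implicit Types (z h c : V) (x : T).

Lemma torus_piP z z' :
  pi z = pi z' <-> exists k : 'rV[int]_N, z' = z + map_mx intr k.
Proof.
have E : reflect (pi z = pi z') (lattice_rel z z').
  exact: (@eqmodP _ (@lattice_equiv R N)).
by split=> [/E/asboolP|/asboolP/E].
Qed.

Lemma torus_pi_lattice z (k : 'rV[int]_N) : pi (z + map_mx intr k) = pi z.
Proof. by apply/esym/torus_piP; exists k. Qed.

Lemma torus_pi_surj x : exists z, pi z = x.
Proof. by exists (repr x); exact: reprK. Qed.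

Lemma torus_continuousP (Z : topologicalType) (u : T -> Z) :
  continuous u <-> continuous (u \o pi).
Proof. exact: quotient_continuous. Qed.

Lemma torus_pi_continuous : continuous pi.
Proof. exact: pi_continuous. Qed.

Definition near_int (t : R) : int := Num.floor (t + 1 / 2).

(** The representative of h modulo the lattice with coordinates in
    [-1/2, 1/2). *)
Definition center (h : V) : V := \row_i (h ord0 i - (near_int (h ord0 i))%:~R).

Lemma center_lattice h : exists k : 'rV[int]_N, center h = h + map_mx intr k.
Proof.
by exists (\row_i - near_int (h ord0 i)); apply/rowP => i; rewrite !mxE rmorphN.
Qed.

Lemma centerD h (k : 'rV[int]_N) : center (h + map_mx intr k) = center h.
Proof.
apply/rowP => i; rewrite !mxE /near_int (addrAC _ _ (1 / 2)) floorDrz ?intr_int//.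
by rewrite intrKfloor rmorphD /= opprD addrACA subrr addr0.
Qed.

Lemma mx_norm_le h (r : R) : 0 <= r -> (forall i, `|h ord0 i| <= r) -> `|h| <= r.
Proof.
move=> r0 H; rewrite [leLHS]/Num.Def.normr /= mx_normrE.
by apply/bigmax_leP; split=> // -[i j] _ /=; rewrite ord1.
Qed.

Lemma center_le h : `|center h| <= 1 / 2.
Proof.
apply: mx_norm_le => [|i]; first by lra.
rewrite mxE ler_norml; set t := h ord0 i.
have /andP[] := floor_itv (t + 1 / 2); rewrite -/(near_int t) rmorphD /=.
by move=> h1 h2; apply/andP; split; lra.
Qed.

Lemma center_id h : `|h| < 1 / 2 -> center h = h.
Proof.
move=> h2; apply/rowP => i; rewrite mxE.
have := le_lt_trans (coord_le_norm h i) h2; set t := h ord0 i.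
rewrite ltr_norml => /andP[t1 t2].
suff -> : near_int t = 0 by rewrite subr0.
by apply: floor_def; rewrite add0r; apply/andP; split; lra.
Qed.

Lemma exists_coord_norm h : 0 < `|h| -> exists i, `|h ord0 i| = `|h|.
Proof.
move=> h0; have h0' : `|h| != 0 by rewrite gt_eqF.
have [[i j] hij] := mx_norm_neq0 h0'; exists j.
by transitivity (mx_norm h) => //; rewrite hij /= (ord1 i).
Qed.

(** A coordinate of size between 1/4 and 3/4 is at distance at least 1/4 from
    every integer, so reducing h modulo the lattice cannot bring it into the
    support of a bump of radius 1/4. *)
Lemma center_ge h : 1 / 4 <= `|h| <= 3 / 4 -> 1 / 4 <= `|center h|.
Proof.
move=> /andP[h1 h2]; have [|i hi] := @exists_coord_norm h; first by lra.
apply: le_trans (coord_le_norm _ i); rewrite mxE; set t := h ord0 i in hi *.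
rewrite -hi in h1 h2; set k := near_int t.
have [k0|k0] := leP k 0; have [t0|t0] := leP 0 t.
- rewrite (ger0_norm t0) in h1 h2; rewrite (le_trans _ (ler_norm _))//.
  have : k%:~R <= 0 :> R by rewrite lerz0.
  lra.
- rewrite (ltr0_norm t0) in h1 h2.
  have [k1|k1] := leP k (- 1).
    have : k%:~R <= -1 :> R by rewrite -[leRHS](rmorphN1 (intmul 1)) ler_int.
    move=> k1'; rewrite (le_trans _ (ler_norm _))//; lra.
  have -> : k = 0 by apply/eqP; rewrite eq_le k0 -ltzD1 //= addrC -ltrBlDl sub0r.
  by rewrite subr0 (ltr0_norm t0).
- rewrite (ger0_norm t0) in h1 h2.
  have : 1 <= k%:~R :> R by rewrite -[leLHS]/(1%:~R) ler_int.
  move=> k1; rewrite -normrN (le_trans _ (ler_norm _))//; lra.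
- rewrite (ltr0_norm t0) in h1 h2.
  have : 1 <= k%:~R :> R by rewrite -[leLHS]/(1%:~R) ler_int.
  move=> k1; rewrite -normrN (le_trans _ (ler_norm _))//; lra.
Qed.

Lemma torus_pi_center z0 z : pi (z0 + center (z - z0)) = pi z.
Proof.
have [k ->] := center_lattice (z - z0).
by rewrite addrA (addrC z0) subrK torus_pi_lattice.
Qed.

Lemma center_eq z0 z z' : pi z = pi z' -> center (z - z0) = center (z' - z0).
Proof. by move/torus_piP => [k ->]; rewrite addrAC centerD. Qed.

(** The function on the torus that equals g, recentred at z0, in the chart
    around z0. *)
Definition periodize (z0 : V) (g : V -> R) (x : T) : R := g (center (repr x - z0)).

Lemma periodizeE z0 g z : periodize z0 g (pi z) = g (center (z - z0)).
Proof. by congr (g _); apply: center_eq; exact: reprK. Qed.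

(** The reduction modulo the lattice is discontinuous, but only where g
    vanishes: near any z the periodized function is a translate of g. *)
Lemma periodize_local z0 g z z' : (forall h, 1 / 4 <= `|h| -> g h = 0) ->
  `|z' - z| <= 1 / 4 ->
  periodize z0 g (pi z') = g (center (z - z0) + (z' - z)).
Proof.
move=> g0 zz'; rewrite periodizeE; set h := center (z - z0) + (z' - z).
have -> : center (z' - z0) = center h.
  have [k hk] := center_lattice (z - z0).
  have -> : h = (z' - z0) + map_mx intr k.
    by rewrite /h hk; apply/rowP => i; rewrite !mxE; ring.
  by rewrite centerD.
have hle : `|h| <= 3 / 4.
  by rewrite (le_trans (ler_normD _ _))//; have := center_le (z - z0); lra.
have [h4|h4] := ltP `|h| (1 / 4); first by rewrite center_id//; lra.
by rewrite !g0// center_ge// h4.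
Qed.

Lemma periodize_continuous z0 g : continuous g ->
  (forall h, 1 / 4 <= `|h| -> g h = 0) -> continuous (periodize z0 g).
Proof.
move=> cg g0; apply/torus_continuousP => z; apply: normP_continuous => e e0.
have [d d0 H] := continuous_normP (cg (center (z - z0))) e0.
exists (Num.min d (1 / 4)); first by rewrite lt_min d0; lra.
move=> z'; rewrite lt_min => /andP[zd z4] /=.
rewrite (periodize_local z0 g0 (ltW z4)) periodizeE; apply: H.
by rewrite addrC addKr.
Qed.

Lemma torus_lift_cball x z0 : exists2 z, pi z = x & cball z0 (1 / 2) z.
Proof.
have [z <-] := torus_pi_surj x; exists (z0 + center (z - z0)).
  exact: torus_pi_center.
by rewrite /cball /= addrC addKr center_le.
Qed.

Lemma torus_max (u : T -> R) : continuous u -> exists x, forall y, u y <= u x.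
Proof.
move=> /torus_continuousP cu.
have K0 : cball (0 : V) (1 / 2) 0 by rewrite /cball/= subrr normr0; lra.
have [c _ H] := @compact_max R V _ (u \o pi) 0 (compact_cball (a := 0) (r := 1 / 2)) K0
  (fun z _ => cu z).
by exists (pi c) => y; have [z <- Kz] := torus_lift_cball y 0; exact: H.
Qed.

Lemma torus_bounded (u : T -> R) : continuous u ->
  exists2 M : R, 0 <= M & forall y, `|u y| <= M.
Proof.
move=> cu.
have cnu : continuous (fun y => `|u y|).
  move=> y; apply: (@continuous_comp _ _ _ u (fun t : R => `|t|)).
    exact: cu.
  exact: norm_continuous.
by have [x H] := torus_max cnu; exists `|u x|.
Qed.

Lemma norm_le_enorm (p : V) : `|p| <= enorm p.
Proof.
apply: mx_norm_le => [|i]; first exact: sqrtr_ge0.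
rewrite -sqrtr_sqr ler_sqrt ?sumr_ge0// => [|j _]; last exact: sqr_ge0.
by rewrite (bigD1 i)//= lerDl sumr_ge0// => j _; exact: sqr_ge0.
Qed.

Lemma convex_hamiltonian_coercive (H : T -> V -> R) : convex_hamiltonian H ->
  coercive_ham (fun z p => H (pi z) p).
Proof.
move=> [cH cvx [alpha [beta [al _ bnd]]]]; split.
- move=> zp.
  apply: (@continuous_comp _ _ _ (fun zp : V * V => (pi zp.1, zp.2))
    (fun xp : T * V => H xp.1 xp.2)); last exact: cH.
  exact: (continuous_map_fst torus_pi_continuous).
- move=> z p q s t s0 t0 st.
  have s1 : 0 <= s <= 1 by apply/andP; split; lra.
  have [i si] : exists i : {i01 R}, i%:num = s.
    by exists (Itv01 (ltW s0) (proj2 (andP s1))).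
  have := cvx (pi z) i p q (mem_set I) (mem_set I).
  have -> : t = 1 - i%:num by rewrite si; lra.
  by rewrite -si.
- move=> K; move/cvgryPgt : al => /(_ K) [L [_ HL]].
  exists L => z p Hp; rewrite leNgt; apply/negP => Lp.
  have := HL (enorm p) (lt_le_trans Lp (norm_le_enorm p)).
  by have /andP[] := bnd (pi z) p; lra.
Qed.

Lemma torus_lipschitz_continuous (u : T -> R) (C : R) :
  (forall z z', `|u (pi z) - u (pi z')| <= C * `|z - z'|) -> continuous u.
Proof.
move=> uC; apply/torus_continuousP => z; apply: normP_continuous => e e0.
exists (e / (`|C| + 1)) => [|y yz]; first by rewrite divr_gt0// ltr_wpDl.
rewrite ltr_pdivlMr ?ltr_wpDl// in yz.
rewrite (le_lt_trans (uC _ _))// (le_lt_trans _ yz)// mulrC ler_wpM2l//.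
by have := ler_norm C; lra.
Qed.

End TorusLift.

(** * First-order expansions and cones *)

Section Frechet.
Variables (R : realType) (N : nat).
Local Notation V := 'rV[R]_N.
Implicit Types (p q h z : V).

Lemma dotrBr p h h' : dotr p (h - h') = dotr p h - dotr p h'.
Proof. by rewrite -sumrB; apply: eq_bigr => i _; rewrite !mxE mulrBr. Qed.

Lemma dotrZr p (t : R) h : dotr p (t *: h) = t * dotr p h.
Proof. by rewrite mulr_sumr; apply: eq_bigr => i _; rewrite !mxE mulrCA. Qed.

Lemma dotrDr p h h' : dotr p (h + h') = dotr p h + dotr p h'.
Proof. by rewrite -big_split; apply: eq_bigr => i _; rewrite !mxE mulrDr. Qed.

Lemma dotr_delta p (s : R) i : dotr p (s *: delta_mx 0 i) = s * p ord0 i.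
Proof.
rewrite dotrZr; congr (_ * _); rewrite /dotr (bigD1 i)//= mxE !eqxx mulr1.
by rewrite big1 ?addr0// => j /negPf ji; rewrite mxE ji andbF mulr0.
Qed.

Lemma dotr_continuous p : continuous (dotr p).
Proof.
move=> h; apply: normP_continuous => e e0.
have c0 : 0 < N%:R * `|p| + 1 by rewrite ltr_wpDl// mulr_ge0.
exists (e / (N%:R * `|p| + 1)) => [|y]; first by rewrite divr_gt0.
rewrite ltr_pdivlMr// -dotrBr => yh; rewrite (le_lt_trans (norm_dotr _ _))//.
by rewrite (le_lt_trans _ yh)// mulrC ler_wpM2l// lerDl.
Qed.

Lemma norm_continuousB z : continuous (fun y : V => `|y - z|).
Proof.
move=> h; apply: normP_continuous => e e0; exists e => // y yh.
rewrite (le_lt_trans _ yh)//.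
have -> : y - h = (y - z) - (h - z) by rewrite opprB addrA subrK.
exact: ler_dist_dist.
Qed.

Lemma differentiable_expansion (phi : V -> R) z (eta : R) :
  differentiable phi z -> 0 < eta ->
  exists2 r : R, 0 < r & forall h, `|h| < r ->
    `|phi (z + h) - phi z - dotr (grad phi z) h| <= eta * `|h|.
Proof.
move=> dphi eta0; have [_ /eqaddoP H] := (diff_locallyP z phi).1 dphi.
have [r r0 Hr] := (near_normP (0 : V) _).1 (H eta eta0).
exists r => // h hr; have := Hr h; rewrite subr0 => /(_ hr).
rewrite !fctE /= (addrC h) opprD addrA -derive_grad// deriveE//.
Qed.

(** Testing along both directions of each coordinate axis bounds every
    coordinate of q - p, which suffices for the sup norm. *)
Lemma touch_above_cone_slope (f : V -> R) z p q (eta rho : R) : 0 < rho ->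
  (forall h, `|h| < rho -> f z + dotr p h - eta * `|h| <= f (z + h)) ->
  0 <= eta -> touch_above f z q -> `|q - p| <= eta.
Proof.
move=> rho0 Hf eta0 tq; apply: mx_norm_le => // i.
have key (s : R) : s * p ord0 i - eta * `|s| <= s * q ord0 i.
  have [->|s0] := eqVneq s 0; first by rewrite normr0 !mul0r mulr0 subrr.
  have hs : `|s *: (delta_mx 0 i : V)| <= `|s|.
    rewrite normrZ ler_piMr//; apply: mx_norm_le => // j; rewrite mxE eqxx /=.
    by case: (j == i); rewrite ?normr1 ?normr0.
  have s0' : 0 < `|s| by rewrite normr_gt0.
  rewrite -(dotr_delta q) ; apply: (touch_above_dot tq (divr_gt0 rho0 s0')).
  move=> t /andP[t0]; rewrite ltr_pdivlMr// => ts.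
  have hts : `|t *: (s *: (delta_mx 0 i : V))| <= t * `|s|.
    by rewrite normrZ (gtr0_norm t0) ler_wpM2l// ltW.
  have := Hf (t *: (s *: delta_mx 0 i)) (le_lt_trans hts ts).
  rewrite dotrZr dotr_delta; apply: le_trans.
  have := ler_wpM2l eta0 hts; rewrite mulrBr; lra.
have := key 1; have := key (-1); rewrite !mxE normrN normr1 ler_norml.
by move=> h1 h2; apply/andP; split; lra.
Qed.

Lemma continuous_sum (T : topologicalType) (I : Type) (s : seq I) (F : I -> T -> R) :
  (forall i, continuous (F i)) -> continuous (fun x => \sum_(i <- s) F i x).
Proof.
move=> cF; elim: s => [|i s IH] x.
  by rewrite (_ : (fun _ => _) = cst 0); [exact: cst_continuous|apply/funext => y; rewrite big_nil].
rewrite (_ : (fun _ => _) = F i \+ (fun x => \sum_(i <- s) F i x)).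
  exact: continuousD (cF i x) (IH x).
by apply/funext => y; rewrite big_cons.
Qed.

End Frechet.

(** * Coupling matrices *)

Section CouplingMatrices.
Variables (R : realType) (m : nat).

(** The sum of the absolute values of the individual bounds serves for every
    index. *)
Lemma finite_uniform (I : finType) (P : I -> R -> Prop) :
  (forall i a b, a <= b -> P i a -> P i b) -> (forall i, exists a, P i a) ->
  exists2 a, 0 <= a & forall i, P i a.
Proof.
move=> mono /choice[f Pf]; exists (\sum_i `|f i|); first by rewrite sumr_ge0.
move=> i; apply: mono (Pf i); rewrite (le_trans (ler_norm _))//.
by rewrite (bigD1 i)//= lerDl sumr_ge0.
Qed.

(** Start from an index k where v is maximal and enlarge a set I of indices at which
    v is within a known distance of its maximum: irreducibility provides a row
    i in I and a column j outside I with b_ij away from 0, and row i then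
    bounds v_i - v_j, because its other terms are controlled from below by the
    distance D already known. One step replaces D by
    D + a (C + m M D), and I is everything after at most m steps. *)
Lemma row_gap (b : 'M[R]_m) (v : 'I_m -> R) (C a M : R) :
  0 <= C -> 0 <= a -> 0 <= M ->
  (forall i j, `|b i j| <= M) -> (forall i j, j != i -> b i j <= 0) ->
  (forall i, \sum_j b i j = 0) ->
  (forall I : {set 'I_m}, I != finset.set0 -> I \proper [set: 'I_m]%SET ->
    exists i j, [/\ i \in I, j \notin I & 1 <= a * `|b i j|]) ->
  (forall i, \sum_j b i j * v j <= C) ->
  forall i j, v i - v j <= iter m (fun D => D + a * (C + m%:R * M * D)) 0.
Proof.
move=> C0 a0 M0 bM boff bsum birr bC i j.
pose F D := D + a * (C + m%:R * M * D).
have F0 n : 0 <= iter n F 0.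
  by elim: n => //= n IH; rewrite addr_ge0// mulr_ge0// addr_ge0// !mulr_ge0.
have Fle n : iter n F 0 <= iter n.+1 F 0.
  by rewrite /= lerDl mulr_ge0// addr_ge0// !mulr_ge0.
have [k _ kmax] : exists2 k, true & forall l, v l <= v k.
  exists [arg max_(l > i) v l]%O => // l.
  by case: arg_maxP => // k _; apply.
suff [n [I [nI nm Ik IF]]] : exists n (I : {set 'I_m}),
    [/\ I = [set: 'I_m]%SET, (n <= m)%N, k \in I & forall l, l \in I -> v k - v l <= iter n F 0].
  have vkj : v k - v j <= iter n F 0 by apply: IF; rewrite nI finset.in_setT.
  have : iter n F 0 <= iter m F 0.
    move: nm; elim: m => [|q IH]; first by rewrite leqn0 => /eqP ->.
    by rewrite leq_eqVlt => /orP[/eqP -> //|/IH/le_trans]; apply; exact: Fle.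
  by have := kmax i; rewrite -/F; lra.
(* q counts the steps made so far, each of which has added one index to I. *)
have grow n : exists q (I : {set 'I_m}),
    [/\ I = [set: 'I_m]%SET \/ (n < #|I|)%N, (q < #|I|)%N, k \in I
      & forall l, l \in I -> v k - v l <= iter q F 0].
  elim: n => [|n [q [I [nI qI Ik IF]]]].
    exists 0%N, [set k]%SET; split; rewrite ?cards1 ?finset.in_set1//; first by right.
    by move=> l; rewrite finset.in_set1 => /eqP ->; rewrite subrr.
  have [IT|IT] := eqVneq I [set: 'I_m]%SET.
    by exists q, I; split=> //; left.
  have {}nI : (n < #|I|)%N by case: nI IT => [->|//]; rewrite eqxx.
  have I0 : I != finset.set0 by apply/finset.set0Pn; exists k.
  have Ip : I \proper [set: 'I_m]%SET by rewrite finset.properT.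
  have [r [s [rI sI rs]]] := birr I I0 Ip.
  exists q.+1, (s |: I)%SET; rewrite cardsU1 sI add1n; split=> //.
  - by right.
  - by rewrite finset.in_setU Ik orbT.
  - move=> l; rewrite finset.in_setU finset.in_set1 => /orP[/eqP ->|lI]; last first.
      exact: le_trans (IF l lI) (Fle q).
    have vr := IF r rI; rewrite /= /F -/F.
    have rs' : s != r by apply: contraNneq sI => ->.
    have tot : \sum_l b r l * (v l - v r) <= C.
      under eq_bigr do rewrite mulrBr.
      by rewrite sumrB -mulr_suml bsum mul0r subr0.
    have term l' : - (b r l' * (v l' - v r)) <= M * iter q F 0.
      have [->|lr] := eqVneq l' r; first by rewrite subrr mulr0 oppr0 mulr_ge0.
      rewrite -mulNr; have b0 := boff r l' lr.
      have bN : - b r l' <= M by rewrite (le_trans _ (bM r l'))// ler0_norm.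
      have vv : v l' - v r <= iter q F 0 by have := kmax l'; lra.
      have h1 : - b r l' * (v l' - v r) <= - b r l' * iter q F 0.
        by rewrite ler_wpM2l// oppr_ge0.
      by rewrite (le_trans h1)// ler_wpM2r.
    have key : b r s * (v s - v r) <= C + m%:R * M * iter q F 0.
      move: tot; rewrite (bigD1 s)//=.
      have : - (m%:R * M * iter q F 0) <= \sum_(l' | l' != s) b r l' * (v l' - v r).
        rewrite lerNl -sumrN -mulrA mulr_natl.
        apply: le_trans (_ : \sum_(l' < m | l' != s) M * iter q F 0 <= _).
          by apply: ler_sum => l' _; exact: term.
        rewrite sumr_const -[leRHS]mulr_natl -[leLHS]mulr_natl ler_wpM2r ?mulr_ge0//.
        by rewrite ler_nat (leq_trans (max_card _))// card_ord.
      lra.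
    have [vrs|vrs] := leP (v r) (v s).
      have : 0 <= a * (C + m%:R * M * iter q F 0).
        by rewrite mulr_ge0// addr_ge0// !mulr_ge0.
      lra.
    have : v r - v s <= a * (b r s * (v s - v r)).
      have -> : a * (b r s * (v s - v r)) = (a * `|b r s|) * (v r - v s).
        by rewrite ler0_norm ?boff//; ring.
      by rewrite ler_peMl// subr_ge0 ltW.
    have := ler_wpM2l a0 key; lra.
have [q [I [IT qI Ik IF]]] := grow m.
have cI : (#|I| <= m)%N by rewrite -[m in (_ <= m)%N]card_ord max_card.
exists q, I; split=> //; last by rewrite ltnW// (leq_trans qI).
by case: IT => // mI; have := leq_trans mI cI; rewrite ltnn.
Qed.

End CouplingMatrices.

(** * Subsolutions with a margin and the maximum principle *)

Section System.
Variables (R : realType) (N m : nat).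
Variable H : 'I_m -> torus R N -> 'rV[R]_N -> R.
Variable B : torus R N -> 'M[R]_m.
Hypothesis H_ham : forall i, convex_hamiltonian (H i).
Hypothesis B_cont : forall i j, continuous (fun x => B x i j).
Hypothesis B_coupling : forall x, degenerate_coupling (B x).
Hypothesis B_irr : forall x, irreducible_mx (B x).
Local Notation V := 'rV[R]_N.
Local Notation T := (torus R N).
Local Notation pi := (@torus_pi R N).
Implicit Types (u v w : 'I_m -> T -> R) (theta : 'I_m -> T -> R) (x y : T).

Definition lift_ham i (z p : V) : R := H i (pi z) p.

(** Component i satisfies its critical inequality with the margin theta_i(x);
    the zero margin gives the critical subsolutions. A margin that is a
    function of x, rather than a constant on an open set, lets convex
    combinations be formed without any localization. *)
Definition strict_subsolution theta w : Prop :=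
  (forall i, continuous (w i)) /\
  forall i, visc_sub (lift_ham i) (w i \o pi)
    (fun z => - coupling B w (pi z) i - theta i (pi z)).

Lemma lift_ham_coercive i : coercive_ham (lift_ham i).
Proof. exact: convex_hamiltonian_coercive. Qed.

Lemma coupling_offdiag x i j : j != i -> B x i j <= 0.
Proof. by have [[+ _] _] := B_coupling x; apply. Qed.

Lemma coupling_rowsum x i : \sum_j B x i j = 0.
Proof. by have [_] := B_coupling x. Qed.

Lemma coupling_diag x i : 0 <= B x i i.
Proof.
have := coupling_rowsum x i; rewrite (bigD1 i)//= => /eqP.
rewrite addr_eq0 => /eqP ->; rewrite oppr_ge0; apply: sumr_le0 => j.
exact: coupling_offdiag.
Qed.

Lemma coupling_shift w x i (c : R) :
  coupling B w x i = \sum_j B x i j * (w j x - c).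
Proof.
rewrite /coupling; under [RHS]eq_bigr do rewrite mulrBr.
by rewrite sumrB -mulr_suml coupling_rowsum mul0r subr0.
Qed.

Lemma coupling_continuous w i : (forall j, continuous (w j)) ->
  continuous (fun x => coupling B w x i).
Proof.
move=> cw; apply: (@continuous_sum _ _ _ _ (fun j x => B x i j * w j x)) => j x.
by apply: (@continuousM _ _ (fun y => B y i j) (w j)); [exact: B_cont|exact: cw].
Qed.

Lemma subsolution_strict0 w :
  subsolution H B 0 w <-> strict_subsolution (fun _ _ => 0) w.
Proof.
split=> -[cw sub]; split=> //.
  move=> i z p [phi [c1 gp loc]].
  have sd : superdiff (w i) (pi z) p by exists z, phi.
  by have := sub (pi z) i p sd; rewrite /lift_ham; lra.
move=> x i p [z [phi [<- c1 gp loc]]].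
have tp : touch_above (w i \o pi) z p by exists phi.
by have := sub i z p tp; rewrite /lift_ham; lra.
Qed.

Lemma supersolution_visc u : supersolution H B 0 u ->
  forall i, visc_super (lift_ham i) (u i \o pi) (fun z => - coupling B u (pi z) i).
Proof.
move=> [_ sup] i z p [phi [c1 gp loc]].
suff sd : subdiff (u i) (pi z) p.
  by have := sup (pi z) i p sd; rewrite /lift_ham; lra.
exists z, ((-1 : R) \*: phi); split.
- by [].
- exact: C1_nearZ c1.
- by rewrite gradZ ?gp ?scaleN1r ?opprK//; exact: C1_near_diff c1.
- by move: loc; apply: filterS => y; rewrite /= /GRing.scale /=; lra.
Qed.

Lemma coupling_lin w w' x i (s t : R) :
  coupling B (fun j y => s * w j y + t * w' j y) x i =
  s * coupling B w x i + t * coupling B w' x i.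
Proof.
rewrite /coupling !mulr_sumr -big_split; apply: eq_bigr => j _ /=; ring.
Qed.

Lemma strict_subsolution_convex theta1 theta2 w1 w2 (s t : R) :
  (forall i, continuous (theta1 i)) -> (forall i, continuous (theta2 i)) ->
  0 < s -> 0 < t -> s + t = 1 ->
  strict_subsolution theta1 w1 -> strict_subsolution theta2 w2 ->
  strict_subsolution (fun i x => s * theta1 i x + t * theta2 i x)
    (fun i x => s * w1 i x + t * w2 i x).
Proof.
move=> ct1 ct2 s0 t0 st [cw1 sub1] [cw2 sub2].
have crhs theta w i : (forall j, continuous (theta j)) -> (forall j, continuous (w j)) ->
    continuous (fun z => - coupling B w (pi z) i - theta i (pi z)).
  move=> ct cw; apply/(torus_continuousP (fun x => - coupling B w x i - theta i x)) => x.
  have c1 := continuousN (coupling_continuous (i := i) cw (x := x)).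
  exact: continuousB c1 (ct i x).
split=> [i x|i].
  have c1 := continuousZl_tmp (k := s) (cw1 i x).
  exact: continuousD c1 (continuousZl_tmp (k := t) (cw2 i x)).
have cl w j : (forall j, continuous (w j)) -> continuous (w j \o pi).
  by move=> cw; apply/torus_continuousP.
have := visc_sub_convex (lift_ham_coercive i) (cl w1 i cw1) (cl w2 i cw2)
  (crhs theta1 w1 i ct1 cw1) (crhs theta2 w2 i ct2 cw2) s0 t0 st (sub1 i) (sub2 i).
move=> sub z p tp; have := sub z p tp; rewrite coupling_lin; lra.
Qed.

(** At a maximum point the terms b_jk (w_k - u_k - M) are all nonnegative while
    the comparison bounds their sum by - theta_j, so all of them vanish, as
    does theta_j. Irreducibility excludes that only part of the components
    attains the maximum. *)
Lemma max_all_components theta w u (M : R) x i :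
  (forall j, continuous (theta j)) -> (forall j y, 0 <= theta j y) ->
  strict_subsolution theta w -> supersolution H B 0 u ->
  (forall j y, w j y - u j y <= M) -> w i x - u i x = M ->
  forall j, w j x - u j x = M /\ theta j x = 0.
Proof.
move=> ct th0 [cw sub] sup wuM wux.
have [cu _] := sup.
have step j : w j x - u j x = M ->
    theta j x = 0 /\ forall k, B x j k != 0 -> w k x - u k x = M.
  move=> wuj; have [z zx] := torus_pi_surj x.
  have cl v k : (forall j, continuous (v j)) -> continuous (v k \o pi).
    by move=> cv; apply/torus_continuousP.
  have cmp := visc_comparison (z0 := z) (lift_ham_coercive j) (cl w j cw) (cl u j cu)
    _ _ (sub j) (supersolution_visc sup (i := j)) _.
  have {cmp} : - coupling B u x j <= - coupling B w x j - theta j x.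
    rewrite -zx; apply: cmp.
    - apply/(torus_continuousP (fun x => - coupling B w x j - theta j x)) => y.
      have c1 := continuousN (coupling_continuous (i := j) cw (x := y)).
      exact: continuousB c1 (ct j y).
    - apply/(torus_continuousP (fun x => - coupling B u x j)) => y.
      exact: continuousN (coupling_continuous (i := j) cu (x := y)).
    - by apply/near_normP; exists 1 => // y _ /=; rewrite zx wuj; exact: wuM.
  have term k : 0 <= B x j k * (w k x - u k x - M).
    have [->|kj] := eqVneq k j; first by rewrite wuj subrr mulr0.
    by rewrite mulr_le0 ?subr_le0 ?coupling_offdiag// eq_sym.
  have sumE : coupling B w x j - coupling B u x j = \sum_k B x j k * (w k x - u k x - M).
    have := coupling_shift (fun k y => w k y - u k y) x j M => <-.
    by rewrite /coupling -sumrB; apply: eq_bigr => k _; rewrite mulrBr.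
  have sum0 : 0 <= \sum_k B x j k * (w k x - u k x - M) by apply: sumr_ge0 => k _; exact: term.
  move=> le; have := th0 j x => th; split; first by apply/eqP; rewrite eq_le th andbT; lra.
  have /eqP : \sum_k B x j k * (w k x - u k x - M) = 0.
    by apply/eqP; rewrite eq_le sum0 andbT; lra.
  rewrite psumr_eq0// => /allP all0 k bk.
  have := all0 k (mem_index_enum k); rewrite /= mulf_eq0 (negPf bk) /= subr_eq0.
  by move/eqP.
pose I := [set j | w j x - u j x == M]%SET.
have [IT|IT] := eqVneq I [set: 'I_m]%SET.
  move=> j; have : j \in I by rewrite IT finset.in_setT.
  by rewrite finset.inE => /eqP wuj; have [] := step j wuj.
have I0 : I != finset.set0.
  by apply/finset.set0Pn; exists i; rewrite finset.inE; apply/eqP.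
have Ip : I \proper [set: 'I_m]%SET by rewrite finset.properT.
have [j [k [jI kI bjk]]] := B_irr x I0 Ip.
move: jI kI; rewrite !finset.inE => /eqP jI /eqP[].
by have [_] := step j jI; apply.
Qed.

(** * Raising a subsolution where it fails to be a supersolution *)

Lemma coupling_add1 w (G : T -> R) i j x :
  coupling B (fun k y => if k == i then w k y + G y else w k y) x j =
  coupling B w x j + B x j i * G x.
Proof.
rewrite /coupling (bigD1 i)//= [in RHS](bigD1 i)//= eqxx mulrDr.
rewrite addrAC; congr (_ + _ + _); apply: eq_bigr => k /negPf ->//.
Qed.

(** Where w_i fails to be a supersolution, p is a subgradient violating the
    inequality by some sigma. The function
    psi h = W(z0) + eps + p.h - 2 eta |h| lies above W = w_i near z0 and no
    longer does at distance r1 from z0; replacing W by the larger of the two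
    keeps a subsolution, as all slopes of psi are within 2 eta of p. The amount added
    is at most eps, so a small multiple of it serves as a margin. The other
    components only benefit, as their coupling to component i is nonpositive.
    The extra point y is kept out of the support of the bump. *)
Lemma bump w x0 i p y : strict_subsolution (fun _ _ => 0) w ->
  subdiff (w i) x0 p -> H i x0 p + coupling B w x0 i < 0 ->
  exists (G : T -> R) (kappa : R),
    [/\ 0 < kappa, continuous G, forall x, 0 <= G x, 0 < G x0 & y <> x0 -> G y = 0]
    /\ strict_subsolution (fun j x => if j == i then kappa * G x else 0)
         (fun j x => if j == i then w j x + G x else w j x).
Proof.
move=> [cw sub] [z0 [phi [zx0 c1 gp loc]]] neg.
pose W := w i \o pi.
have cW : continuous W by apply/torus_continuousP.
pose sigma := - (H i x0 p + coupling B w x0 i).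
have sigma0 : 0 < sigma by rewrite oppr_gt0.
have sigma40 : 0 < sigma / 4 by rewrite divr_gt0.
have [d d0 negd] : exists2 d : R, 0 < d & forall z q, `|z - z0| < d -> `|q - p| < d ->
    lift_ham i z q + coupling B w (pi z) i < - (sigma / 2).
  have [d1 d10 H1] := coercive_ham_unif z0 (`|p|) (lift_ham_coercive i) sigma40.
  have cc : continuous (fun z => coupling B w (pi z) i).
    by apply/(torus_continuousP (fun x => coupling B w x i)); exact: coupling_continuous.
  have [d2 d20 H2] := continuous_normP (cc z0) sigma40.
  exists (Num.min d1 d2) => [|z q]; first by rewrite lt_min d10.
  rewrite !lt_min => /andP[zd1 zd2] /andP[qd1 _].
  have := H2 z zd2; have := H1 z p q (lexx _) zd1 qd1.
  rewrite !ltr_norml /lift_ham zx0 => /andP[_ h1] /andP[_ h2].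
  by rewrite /sigma in h1 h2 *; lra.
have [Mb Mb0 HMb] := torus_bounded (@B_cont i i).
pose eta := d / 4.
have eta0 : 0 < eta by rewrite divr_gt0.
have [rho rho0 Wlow] : exists2 rho : R, 0 < rho & forall h, `|h| < rho ->
    W z0 + dotr p h - eta * `|h| <= W (z0 + h).
  have [r1 r10 Hr1] := differentiable_expansion (C1_near_diff c1) eta0.
  have [r2 r20 Hr2] := (near_normP z0 _).1 loc.
  exists (Num.min r1 r2) => [|h]; first by rewrite lt_min r10.
  rewrite lt_min => /andP[/Hr1 h1 h2].
  have h2' : `|z0 + h - z0| < r2 by rewrite addrC addKr.
  have := Hr2 _ h2'; move: h1; rewrite gp ler_norml /W /= => /andP[h1 _]; lra.
have [zy zyE] := torus_pi_surj y.
pose cy := center (zy - z0).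
(* r1 is the radius of the bump: inside the ranges of the expansion at z0 and
   of the strict inequality, inside the chart, short of y, and such that the
   change B_ii eps in the coupling is at most sigma / 4. *)
pose r1 := Num.min (Num.min rho d) (Num.min (Num.min (1 / 4) (if cy == 0 then 1 else `|cy|))
  (sigma / 4 / (eta * (Mb + 1)))).
have Mb10 : 0 < Mb + 1 by lra.
have r1_gt0 : 0 < r1.
  rewrite !lt_min rho0 d0 !divr_gt0 ?mulr_gt0 ?andbT//=.
  by case: ifPn => // cy0; rewrite normr_gt0.
have r1rho : r1 <= rho by rewrite !ge_min lexx.
have r1d : r1 <= d by rewrite !ge_min lexx orbT.
have r14 : r1 <= 1 / 4 by rewrite !ge_min lexx !orbT.
have r1cy : cy != 0 -> r1 <= `|cy|.
  by move=> /negPf cy0; rewrite /r1 cy0 !ge_min lexx !orbT.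
pose eps := eta * r1.
have eps0 : 0 < eps by rewrite mulr_gt0.
have Mbeps : Mb * eps <= sigma / 4.
  have r1s : r1 <= sigma / 4 / (eta * (Mb + 1)) by rewrite !ge_min lexx !orbT.
  rewrite ler_pdivlMr ?mulr_gt0// in r1s.
  rewrite (le_trans _ r1s)// /eps; have := mulr_gt0 eta0 r1_gt0; lra.
pose psi h := W z0 + eps + dotr p h - 2 * eta * `|h|.
(* The cap eps - eta |h| is inactive for |h| < rho and makes g vanish for all
   |h| >= r1, including where nothing is known about psi. *)
pose g h : R := Num.max 0 (Num.min (eps - eta * `|h|) (psi h - W (z0 + h))).
have cg : continuous g.
  move=> h.
  have cn : {for h, continuous (fun h : V => `|h|)}.
    have := norm_continuousB (z := 0) (x := h).
    rewrite (_ : (fun k : V => `|k - 0|) = (fun h : V => `|h|))//.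
    by apply/funext => k; rewrite subr0.
  have cWs : {for h, continuous (fun h => W (z0 + h))}.
    apply: (@continuous_comp _ _ _ (fun h => z0 + h) W); last exact: cW.
    have cid : {for h, continuous (@id V)} by move=> ?; exact: id.
    have cz0 : {for h, continuous (fun _ : V => z0)} by exact: cst_continuous.
    exact: continuousD cz0 cid.
  have ck (k : R) : {for h, continuous (fun _ : V => k)} by exact: cst_continuous.
  have c2 := continuousB (ck eps) (continuousZl_tmp (k := eta) cn).
  have c3 := continuousB (continuousB (continuousD (ck (W z0 + eps)) (dotr_continuous (p := p) (x := h)))
    (continuousZl_tmp (k := 2 * eta) cn)) cWs.
  exact: continuous_max (ck 0) (continuous_min c2 c3).
have g_ge0 h : 0 <= g h by rewrite le_max lexx.
have g_vanish h : r1 <= `|h| -> g h = 0.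
  move=> rh; apply: max_l; rewrite ge_min subr_le0 /eps.
  by rewrite ler_pM2l// rh.
have g_ge h : `|h| < rho -> psi h - W (z0 + h) <= g h.
  move=> hr; rewrite le_max le_min lexx andbT.
  by apply/orP; right; have := Wlow h hr; rewrite /psi; lra.
have g_pos h : 0 < g h -> `|h| < r1 /\ g h = psi h - W (z0 + h).
  move=> gh; have hr1 : `|h| < r1.
    by rewrite ltNge; apply/negP => /g_vanish gh0; rewrite gh0 ltxx in gh.
  split=> //; apply/eqP; rewrite eq_le g_ge ?andbT; last exact: lt_le_trans hr1 r1rho.
  move: gh; rewrite /g; case: (leP (Num.min _ _) 0); first by rewrite ltxx.
  by move=> _ _; rewrite ge_min lexx orbT.
have g_le h : g h <= eps.
  rewrite ge_max (ltW eps0) ge_min gerBl mulr_ge0//; exact: ltW.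
have g00 : g 0 = eps.
  have p0 : dotr p 0 = 0 by rewrite -(scale0r (0 : V)) dotrZr mul0r.
  rewrite /g /psi normr0 !mulr0 p0 !addr0 !subr0.
  by rewrite addrAC subrr add0r minxx max_r// ltW.
have g4 h : 1 / 4 <= `|h| -> g h = 0 by move=> h4; apply: g_vanish; exact: le_trans h4.
pose G := periodize z0 g.
have GE z : G (pi z) = g (center (z - z0)) by exact: periodizeE.
have cG : continuous G by exact: periodize_continuous.
have G0 x : 0 <= G x by exact: g_ge0.
have Geps x : G x <= eps by exact: g_le.
have Gx0 : G x0 = eps.
  rewrite -zx0 GE subrr center_id; first by [].
  by rewrite normr0; lra.
exists G, (sigma / 4 / eps); split.
  split=> //; first by rewrite divr_gt0.
    by rewrite Gx0.
  move=> yx0; rewrite -zyE GE g_vanish// r1cy//; apply/eqP => cy0; apply: yx0.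
  by rewrite -zyE -zx0 -(torus_pi_center z0 zy) -/cy cy0 addr0.
have kG x : sigma / 4 / eps * G x <= sigma / 4.
  by rewrite mulrAC ler_pdivrMr// ler_pM2l.
split=> [j|j].
  have [_|_] := eqVneq j i; last exact: cw.
  by move=> x; exact: continuousD (cw j x) (cG x).
move=> z q; rewrite coupling_add1; have [->|ji] := eqVneq j i; last first.
  move=> tq; have := sub j z q tq.
  have := mulr_le0_ge0 (coupling_offdiag (pi z) (i := j) (j := i) _) (G0 (pi z)).
  by rewrite eq_sym ji => /(_ isT); lra.
move=> tq; have [Gz|Gz] := eqVneq (G (pi z)) 0.
  rewrite Gz !mulr0; have := sub i z q; rewrite /= => sub'.
  suff /sub' : touch_above (w i \o pi) z q by lra.
  have [phi' [c1' gp' loc']] := tq; exists phi'; split=> //.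
  move: loc'; apply: filterS => z' /=; rewrite Gz.
  by have := G0 (pi z'); lra.
have {}Gz : 0 < G (pi z) by rewrite lt_neqAle eq_sym Gz G0.
pose c := center (z - z0).
have /g_pos[cr1 gc] : 0 < g c by rewrite -GE.
have pic : pi (z0 + c) = pi z by exact: torus_pi_center.
have [k ck] := center_lattice (z - z0).
have pich h : pi (z0 + (c + h)) = pi (z + h).
  rewrite -(torus_pi_lattice (z + h) k); congr (pi _).
  by rewrite /c ck; apply/rowP => l; rewrite !mxE; ring.
have qp : `|q - p| <= 2 * eta.
  have rc : 0 < Num.min (1 / 4) (rho - `|c|).
    by rewrite lt_min subr_gt0 (lt_le_trans cr1 r1rho) andbT; lra.
  apply: (touch_above_cone_slope rc _ _ tq); last by lra.
  move=> h; rewrite lt_min => /andP[h4 hrho] /=.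
  have zhz : `|z + h - z| <= 1 / 4 by rewrite addrC addKr ltW.
  have := periodize_local z0 g4 zhz; rewrite -/G -/c (addrC z h) addrK => ->.
  rewrite GE -/c gc (addrC h z) -(pich h).
  have -> : w i (pi z) = W (z0 + c) by rewrite /W /= pic.
  have hc : `|c + h| <= `|c| + `|h| by exact: ler_normD.
  have hcr : `|c + h| < rho by lra.
  have := g_ge _ hcr; rewrite /psi dotrDr /W /=.
  have := ler_wpM2l (ltW eta0) hc; lra.
have cd : `|z0 + c - z0| < d by rewrite addrC addKr; exact: lt_le_trans cr1 r1d.
have qpd : `|q - p| < d by rewrite /eta in qp; lra.
have := negd _ _ cd qpd; rewrite /lift_ham pic.
have bG : B (pi z) i i * G (pi z) <= Mb * eps.
  by rewrite ler_pM ?coupling_diag// (le_trans (ler_norm _)).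
have := kG (pi z); lra.
Qed.

(** * Bounds common to all critical subsolutions *)

Lemma B_bounded : exists2 M : R, 0 <= M & forall x i j, `|B x i j| <= M.
Proof.
have [M M0 HM] : exists2 M : R, 0 <= M & forall ij : 'I_m * 'I_m, forall x, `|B x ij.1 ij.2| <= M.
  apply: finite_uniform => [ij a b ab Ha x|ij]; first exact: le_trans (Ha x) ab.
  by have [M _ HM] := torus_bounded (@B_cont ij.1 ij.2); exists M.
by exists M => // x i j; exact: (HM (i, j)).
Qed.

(** For a fixed index set I, the sum of the |b_ij(x)| over i in I and j outside
    I is a positive continuous function of x, hence bounded below on the
    torus; some term of the sum is then at least a fixed fraction of this
    bound. There are finitely many I. *)
Lemma uniform_irreducibility : exists2 a : R, 0 <= a &
  forall (x : T) (I : {set 'I_m}), I != finset.set0 -> I \proper [set: 'I_m]%SET ->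
    exists i j, [/\ i \in I, j \notin I & 1 <= a * `|B x i j|].
Proof.
pose P (I : {set 'I_m}) a := I != finset.set0 -> I \proper [set: 'I_m]%SET ->
  forall x, exists i j, [/\ i \in I, j \notin I & 1 <= a * `|B x i j|].
suff [a a0 Pa] : exists2 a, 0 <= a & forall I, P I a.
  by exists a => // x I I0 Ip; exact: Pa.
apply: finite_uniform => [I a b ab Pa I0 Ip x|I].
  have [i [j [iI jI ij]]] := Pa I0 Ip x; exists i, j; split=> //.
  by rewrite (le_trans ij)// ler_wpM2r.
have [I0|I0] := boolP (I != finset.set0); last by exists 0 => /(negP I0).
have [Ip|Ip] := boolP (I \proper [set: 'I_m]%SET); last by exists 0 => _ /(negP Ip).
pose t i j (x : T) : R := (i \in I)%:R * (j \notin I)%:R * `|B x i j|.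
pose r x := \sum_i \sum_j t i j x.
have t0 i j x : 0 <= t i j x by rewrite !mulr_ge0.
have cr : continuous (fun x => - r x).
  have cr' : continuous r.
    apply: continuous_sum => i; apply: continuous_sum => j x.
    have c1 : {for x, continuous (fun x => `|B x i j|)}.
      apply: (@continuous_comp _ _ _ (fun x => B x i j) (fun t : R => `|t|)).
        exact: B_cont.
      exact: norm_continuous.
    exact: (continuousZl_tmp (k := (i \in I)%:R * (j \notin I)%:R) c1).
  by move=> x; exact: continuousN (cr' x).
have [x0 Hx0] := torus_max cr.
have rx0 : 0 < r x0.
  have [i [j [iI jI ij]]] := B_irr x0 I0 Ip.
  have tij : 0 < t i j x0 by rewrite /t iI jI !mul1r normr_gt0.
  rewrite /r (bigD1 i)//= (bigD1 j)//= -addrA ltr_wpDr//.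
  by rewrite addr_ge0// sumr_ge0// => k _; rewrite ?sumr_ge0.
exists ((m%:R * m%:R + 1) / r x0) => _ _ x; apply: contrapT => none.
have small i j : (m%:R * m%:R + 1) / r x0 * t i j x <= 1.
  rewrite /t; have [iI|] := boolP (i \in I); last by rewrite !mul0r mulr0.
  have [jI|] := boolP (j \notin I); last by rewrite mulr0 mul0r mulr0.
  rewrite !mul1r leNgt; apply/negP => h; apply: none; exists i, j; split=> //.
  exact: ltW.
set c := (_ / r x0) in small *.
have : c * r x <= m%:R * m%:R.
  rewrite /r mulr_sumr.
  have -> : m%:R * m%:R = \sum_(i < m) \sum_(j < m) (1 : R).
    by rewrite !sumr_const !card_ord -mulrnA natrM.
  apply: ler_sum => i _; rewrite mulr_sumr; apply: ler_sum => j _; exact: small.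
have : m%:R * m%:R + 1 <= c * r x.
  rewrite /c mulrAC ler_pdivlMr// ler_wpM2l//.
  by have := Hx0 x; rewrite lerN2.
lra.
Qed.

Lemma lift_ham_lower : exists2 C : R, 0 <= C & forall i z p, - C <= lift_ham i z p.
Proof.
apply: finite_uniform => [i a b ab Ha z p|i].
  by rewrite (le_trans _ (Ha z p))// lerN2.
have [ch _ coer] := lift_ham_coercive i.
have [L HL] := coer 0.
pose K := cball (0 : V) (1 / 2) `*` cball (0 : V) (Num.max L 0).
have cK : compact K by apply: compact_setX; exact: compact_cball.
have K0 : K (0, 0).
  by split; rewrite /cball/= subrr normr0 ?le_max ?lexx ?orbT//; lra.
have [c _ Hc] := @compact_max R (V * V)%type K (fun zp : V * V => - lift_ham i zp.1 zp.2)
  (0, 0) cK K0 (fun (zp : V * V) _ => continuousN (ch zp)).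
exists (Num.max 0 (- lift_ham i c.1 c.2)) => z p.
have [hp|hp] := leP (lift_ham i z p) 0; last first.
  by rewrite lerNl le_max; apply/orP; left; lra.
have [z' zz' Kz'] := torus_lift_cball (pi z) 0.
have Kp : cball (0 : V) (Num.max L 0) p by rewrite /cball/= subr0 le_max (HL z p hp).
have := Hc (z', p) (conj Kz' Kp); rewrite /= /lift_ham zz' => h.
by rewrite lerNl le_max h orbT.
Qed.

(** The inequality of component i together with the lower bound of the
    Hamiltonian bounds the coupling term at every point that carries a slope;
    such points are dense. *)
Lemma coupling_upper : exists2 C : R, 0 <= C &
  forall v, strict_subsolution (fun _ _ => 0) v -> forall x i, coupling B v x i <= C.
Proof.
have [C C0 HC] := lift_ham_lower; exists C => // v [cv sub] x i.
have [z <-] := torus_pi_surj x; apply/ler_addgt0Pr => e e0.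
have cc : continuous (fun z => coupling B v (pi z) i).
  by apply/(torus_continuousP (fun x => coupling B v x i)); exact: coupling_continuous.
have [d d0 Hd] := continuous_normP (cc z) e0.
have cvi : continuous (v i \o pi) by apply/torus_continuousP.
have [z' [p [zz' tp]]] := touch_above_dense z cvi d0.
have := sub i z' p tp; have := HC i z' p; have := Hd z' zz'.
by rewrite ltr_norml => /andP[? ?]; lra.
Qed.

Lemma subsolution_gap : exists2 D : R, 0 <= D &
  forall v, strict_subsolution (fun _ _ => 0) v -> forall x i j, v i x - v j x <= D.
Proof.
have [C C0 HC] := coupling_upper; have [M M0 HM] := B_bounded.
have [a a0 Ha] := uniform_irreducibility.
pose D := iter m (fun D => D + a * (C + m%:R * M * D)) 0.
have HD v x i j : strict_subsolution (fun _ _ => 0) v -> v i x - v j x <= D.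
  move=> sv; apply: (row_gap (b := B x) (v := fun k => v k x)) => //.
  - by move=> k l; exact: coupling_offdiag.
  - by move=> k; exact: coupling_rowsum.
  - by move=> I; exact: Ha.
  - by move=> k; exact: HC.
exists `|D| => // v sv x i j; exact: le_trans (HD v x i j sv) (ler_norm _).
Qed.

(** The gap bounds the coupling terms from both sides, so the Hamiltonians are
    bounded above along all slopes, and coercivity bounds the slopes. *)
Lemma subsolution_equilipschitz : exists2 L : R, 0 <= L &
  forall v, strict_subsolution (fun _ _ => 0) v ->
  forall i z z', `|v i (pi z) - v i (pi z')| <= L * `|z - z'|.
Proof.
have [D D0 HD] := subsolution_gap; have [M M0 HM] := B_bounded.
have [L L0 HL] : exists2 L, 0 <= L & forall i z p, lift_ham i z p <= m%:R * (M * D) -> `|p| <= L.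
  apply: finite_uniform => [i a b ab Ha z p /Ha h|i]; first exact: le_trans h ab.
  by have [_ _ coer] := lift_ham_coercive i; exact: coer.
exists (N%:R * L + 1) => [|v sv i]; first by rewrite addr_ge0// mulr_ge0.
have [cv sub] := sv; have [Mv _ HMv] := torus_bounded (cv i).
apply: (@bounded_touch_lipschitz _ _ (v i \o pi) Mv) => //.
- by apply/torus_continuousP.
- by move=> z; exact: HMv.
- move=> z p tp; apply: (HL i z); rewrite (le_trans (sub i z p tp))// subr0.
  rewrite (coupling_shift v (pi z) i (v i (pi z))) -sumrN.
  have -> : m%:R * (M * D) = \sum_(j < m) M * D by rewrite sumr_const card_ord mulr_natl.
  apply: ler_sum => j _; have [->|ji] := eqVneq j i; first by rewrite subrr mulr0 oppr0 mulr_ge0.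
  have b0 := coupling_offdiag (pi z) ji.
  rewrite -mulNr; have h1 : - B (pi z) i j * (v j (pi z) - v i (pi z)) <= - B (pi z) i j * D.
    by rewrite ler_wpM2l ?oppr_ge0//; exact: HD.
  by rewrite (le_trans h1)// ler_wpM2r// (le_trans _ (HM (pi z) i j))// ler0_norm.
Qed.

Lemma subsolution_osc : exists D : R,
  forall v, strict_subsolution (fun _ _ => 0) v -> forall i j x y, v i x - v j y <= D.
Proof.
have [D D0 HD] := subsolution_gap; have [L L0 HL] := subsolution_equilipschitz.
exists (D + L) => v sv i j x y.
have [zx xE] := torus_pi_surj x.
have [zy yE Kzy] := torus_lift_cball y zx.
have := HL v sv i zx zy; rewrite xE yE => h1.
have := HD v sv y i j; have := ler_norm (v i x - v i y).
have : L * `|zx - zy| <= L.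
  by rewrite ler_piMr// distrC (le_trans Kzy)//; lra.
lra.
Qed.

(** * The maximal subsolutions Phi *)

Section PhiSection.
Variables (v0 : 'I_m -> T -> R) (j : 'I_m) (y : T).
Hypothesis v0_sub : strict_subsolution (fun _ _ => 0) v0.
Local Notation W := (fun i x => Phi H B i j y x).

Lemma Phi_ub v i x : strict_subsolution (fun _ _ => 0) v ->
  v i x - v j y <= Phi H B i j y x.
Proof.
move=> /[dup] sv /subsolution_strict0 sv'; apply: ub_le_sup; last by exists v.
have [D HD] := subsolution_osc; exists D => _ [v' /subsolution_strict0 sv'' <-].
exact: HD.
Qed.

Lemma Phi_adherent i x (e : R) : 0 < e ->
  exists2 v, strict_subsolution (fun _ _ => 0) v & Phi H B i j y x - e < v i x - v j y.
Proof.
move=> e0.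
have hs : has_sup [set v i x - v j y | v in subsolution H B 0].
  split; first by exists (v0 i x - v0 j y), v0 => //; apply/subsolution_strict0.
  have [D HD] := subsolution_osc; exists D => _ [v' /subsolution_strict0 sv'' <-].
  exact: HD.
by have [_ [v /subsolution_strict0 sv <-] h] := sup_adherent e0 hs; exists v.
Qed.

Lemma Phi_diag : Phi H B j j y y = 0.
Proof.
apply/eqP; rewrite eq_le; apply/andP; split.
  apply/ler_addgt0Pr => e e0; rewrite add0r.
  by have [v _] := Phi_adherent j y e0; rewrite subrr; lra.
by have := Phi_ub j y v0_sub; rewrite subrr.
Qed.

Lemma Phi_continuous i : continuous (W i).
Proof.
have [L L0 HL] := subsolution_equilipschitz.
have one z z' : W i (pi z) - W i (pi z') <= L * `|z - z'|.
  apply/ler_addgt0Pr => e e0.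
  have [v sv hv] := Phi_adherent i (pi z) e0.
  have := Phi_ub i (pi z') sv; have := HL v sv i z z'.
  have := ler_norm (v i (pi z) - v i (pi z')); lra.
apply: (@torus_lipschitz_continuous _ _ _ L) => z z'.
rewrite ler_norml one andbT; have := one z' z; rewrite distrC; lra.
Qed.

(** A member v that almost reaches the supremum in component i may be far
    below it in the others. As the off-diagonal coefficients are nonpositive,
    passing from v to the supremum there only lowers the coupling, and the
    diagonal term changes by little. *)
Lemma Phi_subsolution : strict_subsolution (fun _ _ => 0) W.
Proof.
split=> [i|i z0 p tp]; first exact: Phi_continuous.
rewrite subr0; apply/ler_addgt0Pr => e e0.
have e40 : 0 < e / 4 by rewrite divr_gt0.
have [d1 d10 H1] := coercive_ham_unif z0 (`|p|) (lift_ham_coercive i) e40.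
have cc : continuous (fun z => coupling B W (pi z) i).
  apply/(torus_continuousP (fun x => coupling B W x i)); apply: coupling_continuous.
  by move=> k; exact: Phi_continuous.
have [d2 d20 H2] := continuous_normP (cc z0) e40.
have [M M0 HM] := B_bounded.
have M10 : 0 < M + 1 by lra.
pose r := Num.min (Num.min d1 d2) (e / 4 / (M + 1)).
have r0 : 0 < r by rewrite !lt_min d10 d20 divr_gt0.
have Mr : M * r <= e / 4.
  have : r <= e / 4 / (M + 1) by rewrite ge_min lexx orbT.
  by rewrite ler_pdivlMr//; lra.
have cWi : continuous (W i \o pi) by apply/torus_continuousP; exact: Phi_continuous.
have [eta eta0 Heta] := touch_above_sup cWi tp r0.
have [v sv hv] := Phi_adherent i (pi z0) eta0.
have [cv sub] := sv.
pose c := v j y.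
have cvc : continuous (fun z => v i (pi z) - c).
  have cvi : continuous (v i \o pi) by apply/torus_continuousP.
  have ck z : {for z, continuous (fun _ : V => c)} by exact: cst_continuous.
  by move=> z; exact: continuousB (cvi z) (ck z).
have [|x [P [xr Pr Wx tP]]] := Heta _ cvc _ hv.
  by move=> z; exact: Phi_ub.
have tv : touch_above (v i \o pi) x P.
  have [phi [c1 gp loc]] := tP; exists phi; split=> //.
  by move: loc; apply: filterS => z /=; lra.
have := sub i x P tv; rewrite subr0 => subx.
have r1 : r <= d1 by rewrite !ge_min lexx.
have r2 : r <= d2 by rewrite !ge_min lexx orbT.
have := H1 x p P (lexx _) (lt_le_trans xr r1) (lt_le_trans Pr r1).
have := H2 x (lt_le_trans xr r2).
rewrite !ltr_norml => /andP[h2 _] /andP[h1 _].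
suff : coupling B W (pi x) i - e / 4 <= coupling B v (pi x) i by lra.
rewrite (coupling_shift v (pi x) i c) lerBlDr -lerBlDl /coupling -sumrB (bigD1 i)//=.
have rest : \sum_(k | k != i) (B (pi x) i k * W k (pi x) - B (pi x) i k * (v k (pi x) - c)) <= 0.
  apply: sumr_le0 => k ki; rewrite -mulrBr mulr_le0_ge0 ?coupling_offdiag//.
  by rewrite subr_ge0; exact: Phi_ub.
have : B (pi x) i i * W i (pi x) - B (pi x) i i * (v i (pi x) - c) <= M * r.
  rewrite -mulrBr ler_pM ?coupling_diag//.
  - by rewrite subr_ge0; exact: Phi_ub.
  - exact: le_trans (ler_norm _) (HM _ _ _).
  - by move: Wx => /= /ltW.
lra.
Qed.

(** If the failure to be a supersolution occurs in a component other than j, or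
    at a point other than y, then raising Phi there keeps component j equal to
    0 at y and gives a critical subsolution exceeding Phi, which contradicts its
    definition. In the remaining case the raised function has the margin
    sought. *)
Lemma strict_off_aubry : ~ aubry H B j y ->
  exists w theta, [/\ strict_subsolution theta w,
    forall i, continuous (theta i), forall i x, 0 <= theta i x & 0 < theta j y].
Proof.
move=> nA.
have : ~ supersolution H B 0 W.
  move=> sup; apply: nA; split=> //; apply/subsolution_strict0.
  exact: Phi_subsolution.
move=> /not_andP[/(_ (fun i => Phi_continuous (i := i)))//|].
move=> /existsNP[x0 /existsNP[i /existsNP[p /not_implyP[sd /negP]]]].
rewrite -ltNge => neg.
have [G [kappa [[k0 cG G0 Gx0 Gy] sW]]] := bump y Phi_subsolution sd neg.
have th0 k x : 0 <= (if k == i then kappa * G x else 0).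
  by case: ifP => // _; rewrite mulr_ge0// ltW.
have cth k : continuous (fun x => if k == i then kappa * G x else 0).
  case: (k == i) => x; last exact: cst_continuous.
  exact: (continuousZl_tmp (k := kappa) (cG x)).
have [ij|ij] := eqVneq i j; have [xy|/eqP xy] := eqVneq x0 y.
- eexists; exists (fun k x => if k == i then kappa * G x else 0); split; [exact: sW|..] => //.
  by rewrite -ij eqxx -xy mulr_gt0.
all: exfalso; pose w' k x := if k == i then Phi H B k j y x + G x else Phi H B k j y x.
all: have sw' : strict_subsolution (fun _ _ => 0) w'
  by case: sW => cw' sub'; split=> // k z q /sub' h; rewrite subr0 (le_trans h)// gerBl.
all: have := Phi_ub i x0 sw'; rewrite /w' eqxx.
- have Gy0 : G y = 0 by apply: Gy => yx; exact: xy.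
  by rewrite ij eqxx Phi_diag Gy0; move: Gx0; lra.
- by rewrite eq_sym (negPf ij) Phi_diag; move: Gx0; lra.
- by rewrite eq_sym (negPf ij) Phi_diag; move: Gx0; lra.
Qed.

End PhiSection.

(** * Comparison *)

(** The points of K each come with a subsolution having a positive margin on a
    neighbourhood; finitely many neighbourhoods cover K, and successive
    averages keep every margin that was positive. *)
Lemma strict_on_compact (j : 'I_m) v0 (K : set V) : compact K ->
  strict_subsolution (fun _ _ => 0) v0 ->
  (forall z, K z -> ~ aubry H B j (pi z)) ->
  exists w theta, [/\ strict_subsolution theta w,
    forall i, continuous (theta i), forall i x, 0 <= theta i x
    & forall z, K z -> 0 < theta j (pi z)].
Proof.
move=> cK sv0 KA.
pose good (wt : ('I_m -> T -> R) * ('I_m -> T -> R)) := [/\ strict_subsolution wt.2 wt.1,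
    forall i, continuous (wt.2 i) & forall i x, 0 <= wt.2 i x].
have /choice[f Hf] : forall z, exists wt, good wt /\ (K z -> 0 < wt.2 j (pi z)).
  move=> z; have [Kz|Kz] := pselect (K z).
    have [w [theta [? ? ? ?]]] := strict_off_aubry sv0 (KA z Kz).
    by exists (w, theta).
  exists (v0, fun _ _ => 0); split=> //; split=> // i.
  exact: cst_continuous.
have [D _ cov] : finite_subset_cover K (fun z => [set z' | 0 < (f z).2 j (pi z')]) K.
  move: cK; rewrite compact_cover; apply.
    move=> z _; have [[_ ct _] _] := Hf z.
    have ctj : continuous ((f z).2 j \o pi) by apply/torus_continuousP.
    exact: (open_comp (fun z' _ => ctj z') (@open_gt R 0)).
  by move=> z Kz; exists z => //; have [_] := Hf z; apply.
suff [wt [[sw ct t0] pos]] : exists wt, good wt /\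
    forall z, z \in enum_fset D -> forall z', 0 < (f z).2 j (pi z') -> 0 < wt.2 j (pi z').
  exists wt.1, wt.2; split=> // z Kz.
  by have [z0 Dz0 hz] := cov z Kz; exact: pos hz.
elim: (enum_fset D) => [|z s [wt [[sw ct t0] pos]]].
  exists (v0, fun _ _ => 0); split=> //; split=> // i.
  exact: cst_continuous.
have [[sw' ct' t0'] _] := Hf z.
exists ((fun i x => 1 / 2 * wt.1 i x + 1 / 2 * (f z).1 i x),
  (fun i x => 1 / 2 * wt.2 i x + 1 / 2 * (f z).2 i x)); split.
  split=> /=.
  - by apply: strict_subsolution_convex => //; lra.
  - move=> i x; have c1 := continuousZl_tmp (k := 1 / 2) (ct i x).
    exact: continuousD c1 (continuousZl_tmp (k := 1 / 2) (ct' i x)).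
  - by move=> i x; have := t0 i x; have := t0' i x; lra.
move=> z1; rewrite inE => /orP[/eqP ->|z1s] z' h /=.
  by have := t0 j (pi z'); lra.
by have := pos z1 z1s z' h; have := t0' j (pi z'); lra.
Qed.

(** The maximum of v - u cannot be positive: it would be attained by all
    components together, away from the Aubry set, where a small admixture of a
    subsolution with a positive margin contradicts the maximum principle. *)
Lemma comparison_on_aubry (j : 'I_m) v u :
  subsolution H B 0 v -> supersolution H B 0 u ->
  (forall x, aubry H B j x -> exists i, v i x <= u i x) ->
  forall x i, v i x <= u i x.
Proof.
move=> /subsolution_strict0 sv su vuA x i; rewrite leNgt; apply/negP => vu.
have [cv _] := sv; have [cu _] := su.
have cvu k : continuous (fun x => v k x - u k x) by move=> y; exact: continuousB (cv k y) (cu k y).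
have [M M0 [[k [xM kM]] Mub]] : exists2 M : R, 0 < M &
    (exists k y, v k y - u k y = M) /\ forall k y, v k y - u k y <= M.
  have /choice[f Hf] : forall k, exists x, forall y, v k y - u k y <= v k x - u k x.
    by move=> k; exact: torus_max (cvu k).
  pose k := [arg max_(k > i) (v k (f k) - u k (f k))]%O.
  have kmax l : v l (f l) - u l (f l) <= v k (f k) - u k (f k).
    by rewrite /k; case: arg_maxP => // k' _; apply.
  have ub l y : v l y - u l y <= v k (f k) - u k (f k).
    exact: le_trans (Hf l y) (kmax l).
  exists (v k (f k) - u k (f k)); last by split; [exists k, (f k)|exact: ub].
  by apply: lt_le_trans (ub i x); rewrite subr_gt0.
have c0 (l : 'I_m) : continuous (fun _ : T => 0 : R) by move=> y; exact: cst_continuous.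

have all_max l y : v l y - u l y = M -> forall k', v k' y - u k' y = M.
  move=> ly k'.
  by have [] := max_all_components c0 (fun _ _ => lexx 0) sv su Mub ly k'.
pose K := cball (0 : V) (1 / 2) `&` [set z | v j (pi z) - u j (pi z) = M].
have cK : compact K.
  apply: compact_closedI; first exact: compact_cball.
  have cj : continuous ((fun y => v j y - u j y) \o pi) by apply/torus_continuousP.
  exact: (closed_comp (fun z _ => cj z) (@closed_eq R M)).
have KA z : K z -> ~ aubry H B j (pi z).
  move=> [_ zM] /vuA[l]; rewrite -subr_le0 (all_max j (pi z) zM l) leNgt M0//.
have [w [theta [sw ct t0 pos]]] := strict_on_compact cK sv KA.
have [cw _] := sw.

have posj y : v j y - u j y = M -> 0 < theta j y.
  by have [z <- Kz] := torus_lift_cball y 0; move=> zM; exact: pos.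
pose F := cball (0 : V) (1 / 2) `&` [set z | theta j (pi z) = 0].
have cF : compact F.
  apply: compact_closedI; first exact: compact_cball.
  have cj : continuous (theta j \o pi) by apply/torus_continuousP.
  exact: (closed_comp (fun z _ => cj z) (@closed_eq R 0)).
(* Where the margin of w vanishes, component j of v - u stays below M by a
   fixed amount. *)
have [eta eta0 Heta] : exists2 eta : R, 0 < eta & forall y, theta j y = 0 ->
    v j y - u j y <= M - eta.
  have [[z0 Fz0]|F0] := pselect (exists z, F z); last first.
    exists 1 => // y ty; exfalso; apply: F0.
    by have [z zy Kz] := torus_lift_cball y 0; exists z; split=> //=; rewrite zy.
  have cj : continuous ((fun y => v j y - u j y) \o pi) by apply/torus_continuousP.
  have [c [_ Fc] Hc] := compact_max cF Fz0 (fun z _ => cj z).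
  exists (M - (v j (pi c) - u j (pi c))).
    rewrite subr_gt0 lt_neqAle Mub andbT; apply/eqP => /posj.
    by rewrite Fc ltxx.
  move=> y ty; rewrite subKr; have [z zy Kz] := torus_lift_cball y 0.
  by rewrite -zy; apply: Hc; split=> //=; rewrite zy.
have [D D0 HD] : exists2 D : R, 0 <= D & forall l, forall y, `|w l y - v l y| <= D.
  apply: finite_uniform => [l a b ab Ha y|l]; first exact: le_trans (Ha y) ab.
  have cwv : continuous (fun y => w l y - v l y) by move=> y; exact: continuousB (cw l y) (cv l y).
  by have [Ml _ HMl] := torus_bounded cwv; exists Ml.
(* With this t the combination (1 - t) v + t w stays within eta / 4 of v, so
   its maximum against u is not attained where the margin of w vanishes. *)
pose t := Num.min (1 / 2) (eta / (4 * (D + 1))).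
have D10 : 0 < 4 * (D + 1) by lra.
have tt0 : 0 < t by rewrite lt_min !divr_gt0.
have t1 : 0 < 1 - t.
  have : t <= 1 / 2 by rewrite ge_min lexx.
  lra.
have tD : t * D <= eta / 4.
  have : t <= eta / (4 * (D + 1)) by rewrite ge_min lexx orbT.
  by rewrite ler_pdivlMr//; lra.
pose vt l y := (1 - t) * v l y + t * w l y.
pose tht (l : 'I_m) y : R := (1 - t) * 0 + t * theta l y.
have svt : strict_subsolution tht vt.
  by apply: (strict_subsolution_convex c0 ct) => //; lra.
have ctht l : continuous (tht l).
  have -> : tht l = t \*: theta l by apply/funext => y; rewrite /tht mulr0 add0r.
  by move=> y; exact: continuousZl_tmp (ct l y).
have tht0 l y : 0 <= tht l y by rewrite /tht mulr0 add0r mulr_ge0// ltW.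
have [cvt _] := svt.
have vtv l y : `|vt l y - v l y| <= eta / 4.
  have -> : vt l y - v l y = t * (w l y - v l y) by rewrite /vt; ring.
  by rewrite normrM gtr0_norm// (le_trans _ tD)// ler_wpM2l// ltW.
have /choice[f Hf] : forall l, exists x, forall y, vt l y - u l y <= vt l x - u l x.
  move=> l; have cl : continuous (fun y => vt l y - u l y).
    by move=> y; exact: continuousB (cvt l y) (cu l y).
  exact: torus_max cl.
pose q := [arg max_(l > i) (vt l (f l) - u l (f l))]%O.
have qmax l : vt l (f l) - u l (f l) <= vt q (f q) - u q (f q).
  by rewrite /q; case: arg_maxP => // k' _; apply.
have ub l y : vt l y - u l y <= vt q (f q) - u q (f q).
  exact: le_trans (Hf l y) (qmax l).
have [jmax] := max_all_components ctht tht0 svt su ub erefl j.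
rewrite /tht mulr0 add0r => /eqP; rewrite mulf_eq0 gt_eqF//= => /eqP thz.
have := Heta _ thz; have := ub k xM; rewrite -jmax.
have := vtv k xM; have := vtv j (f q); rewrite !ler_norml.
move=> /andP[_ h1] /andP[h2 _]; lra.
Qed.

End System.

Theorem theorem5p5 (R : realType) (N m : nat) (N_gt0 : (0 < N)%N)
  (m_gt0 : (0 < m)%N)
  (H : 'I_m -> torus R N -> 'rV[R]_N -> R) (B : torus R N -> 'M[R]_m)
  (H_ham : forall i, convex_hamiltonian (H i))
  (B_cont : forall i j, continuous (fun x => B x i j))
  (B_coupling : forall x, degenerate_coupling (B x))
  (B_irr : forall x, irreducible_mx (B x))
  (c_eq0 : critical_value H B = 0%E)
  (i0 : 'I_m) :
  (forall v u : 'I_m -> torus R N -> R,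
    subsolution H B 0 v -> supersolution H B 0 u ->
    (forall x, aubry H B i0 x -> exists i, v i x <= u i x) ->
    forall x i, v i x <= u i x) /\
  (forall u w : 'I_m -> torus R N -> R,
    solution H B 0 u -> solution H B 0 w ->
    (forall x, aubry H B i0 x -> forall i, u i x = w i x) ->
    forall x i, u i x = w i x).
Proof.
have cmp := comparison_on_aubry H_ham B_cont B_coupling B_irr (j := i0).
split=> [v u|u w [su pu] [sw pw] uw x i]; first exact: cmp.
by apply/eqP; rewrite eq_le; apply/andP; split; apply: cmp => // y Ay;
  exists i0; rewrite uw.
Qed.
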